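(* Let $p\in(0,1)$, $s,t\ge0$ and $u\in(p,1]$. Then for $\xi\ge0$ the limit $\Lambda^{(u)}_{(s,t)}(\xi)=\lim_{N\to\infty}N^{-1}\log\mathbb E\,e^{\xi G^{(u)}_{\lfloor Ns\rfloor,\lfloor Nt\rfloor}}$ exists and is given by $$\Lambda^{(u)}_{(s,t)}(\xi)=\begin{cases}s\,C_{\mathcal B}^{(u)}(\xi)-t\,C_{\mathcal G}^{\left(\frac{u-p}{u(1-p)}\right)}(-\xi), & \text{if }\xi\in\big[0,\log\tfrac{u(1-p)}{p(1-u)}\big)\text{ and }t<\ell^{(u)}(\xi)s,\\ t\,C_{\mathcal G}^{\left(\frac{u-p}{u(1-p)}\right)}(\xi)-s\,C_{\mathcal B}^{(u)}(-\xi), & \text{if }\xi\in\big[0,\log\tfrac{u(1-p)}{p(1-u)}\big)\text{ and }t\ge\ell^{(u)}(\xi)s,\\ \infty, & \text{if }\xi\in\big[\log\tfrac{u(1-p)}{p(1-u)},\infty\big),\end{cases}$$ where $$\ell^{(u)}(\xi)=\frac{C_{\mathcal B}^{(u)}(\xi)+C_{\mathcal B}^{(u)}(-\xi)}{C_{\mathcal G}^{\left(\frac{u-p}{u(1-p)}\right)}(\xi)+C_{\mathcal G}^{\left(\frac{u-p}{u(1-p)}\right)}(-\xi)}.$$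
   Context: Let $\mathbb N=\{1,2,\dots\}$, $\mathbb Z_+=\{0,1,2,\dots\}$. The environment $\{\omega_v\}_{v\in\mathbb Z_+^2}$ consists of independent variables: $\omega_{i,j}\sim$ Bernoulli($p$) for $(i,j)\in\mathbb N^2$; $\omega_{i,0}\sim$ Bernoulli($u$) for $i\in\mathbb N$; $\omega_{0,j}\sim$ Geometric$\big(\frac{u-p}{u(1-p)}\big)$ for $j\in\mathbb N$, i.e. $\mathbb P\{\omega_{0,j}=\ell\}=\frac{u-p}{u(1-p)}\big(\frac{p(1-u)}{u(1-p)}\big)^{\ell}$, $\ell\in\mathbb Z_+$; and $\omega_{0,0}=0$. $G_{v,w}=\max_\pi\sum_i\omega_{v_{i+1}}\mathbf 1\{v_{i+1}-v_i=e_1\}$ is the last passage time from $v$ to $w$, the maximum being over paths $v=v_0,\dots,v_k=w$ with $v_{i+1}-v_i\in\{e_1,e_2\}$. The last passage time of the invariant (boundary) model from the origin to $(m,n)$ is $$G^{(u)}_{m,n}=\max_{1\le k\le m}\Big\{\sum_{i=1}^k\omega_{i,0}+G_{(k,1),(m,n)}\Big\}\ \bigvee\ \max_{1\le k\le n}\Big\{\sum_{j=1}^k\omega_{0,j}+\omega_{1,k}+G_{(1,k),(m,n)}\Big\}$$ for $(m,n)\in\mathbb N^2$, and on the axes $G^{(u)}_{m,0}=\sum_{i=1}^m\omega_{i,0}$ and $G^{(u)}_{0,n}=\sum_{j=1}^n\omega_{0,j}$. $C_{\mathcal B}^{(u)}(\xi)=\log(1-u+ue^{\xi})$; $C_{\mathcal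 G}^{(q)}(\xi)=\log\frac{q}{1-(1-q)e^{\xi}}$ for $\xi<-\log(1-q)$ and $\infty$ otherwise.
   Formalization: The value ∞ for ξ ≥ log(u(1-p)/(p(1-u))) is asserted only when t>0; for t=0 the limit is asserted only to exist, since G is then a sum of ⌊Ns⌋ Bernoulli(u) variables and the true limit s·C_B(ξ) is finite. *)

(* Defs.v *)
From HB Require Import structures.
From mathcomp Require Import all_boot all_order all_algebra.
From mathcomp Require Import all_classical all_reals all_analysis.

Set Implicit Arguments.
Unset Strict Implicit.
Unset Printing Implicit Defensive.

Import Order.TTheory GRing.Theory Num.Theory.
Import numFieldNormedType.Exports.

Local Open Scope classical_set_scope.
Local Open Scope ring_scope.

Definition vertex : Type := (nat * nat)%type.

(* An up-right path from v is encoded by its steps: true is e_1, false is e_2. *)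
Definition step (v : vertex) (b : bool) : vertex :=
  if b then (v.1.+1, v.2) else (v.1, v.2.+1).

Definition path_end (v : vertex) (bs : seq bool) : vertex := foldl step v bs.

(* A path collects the weight of a vertex only when entering it by an e_1 step;
   in particular the weight of the initial vertex is not collected. *)
Fixpoint path_weight (w : vertex -> nat) (v : vertex) (bs : seq bool) : nat :=
  if bs is b :: bs' then
    ((if b then w (step v b) else 0) + path_weight w (step v b) bs')%N
  else 0%N.

(* Every up-right path from v to z has exactly (z - v).1 + (z - v).2 steps.
   The weights are natural numbers, so the value 0 of an empty maximum does not
   interfere; the maximum is over a nonempty set when v <= z. *)
Definition last_passage (w : vertex -> nat) (v z : vertex) : nat :=
  \max_(bs : ((z.1 - v.1) + (z.2 - v.2)).-tuple bool | path_end v bs == z)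
    path_weight w v bs.

Definition boundary_last_passage (w : vertex -> nat) (m n : nat) : nat :=
  match m, n with
  | _, 0 => \sum_(1 <= i < m.+1) w (i, 0)
  | 0, _ => \sum_(1 <= j < n.+1) w (0, j)
  | _, _ =>
      maxn
        (\max_(1 <= k < m.+1)
           ((\sum_(1 <= i < k.+1) w (i, 0)) + last_passage w (k, 1) (m, n)))
        (\max_(1 <= k < n.+1)
           ((\sum_(1 <= j < k.+1) w (0, j)) + w (1, k)
              + last_passage w (1, k) (m, n)))
  end%N.

Section Environment.
Context (d : measure_display) (T : measurableType d) (R : realType).
Variable P : probability T R.

Definition mutually_independent (I : choiceType) (X : I -> {RV P >-> nat}) :
    Prop :=
  forall (J : seq I) (B : I -> set nat), uniq J ->
    P (\bigcap_(i in [set` J]) (X i @^-1` B i)) =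
    (\prod_(i <- J) P (X i @^-1` B i))%E.

Definition bernoulli_law (X : {RV P >-> nat}) (p : R) : Prop :=
  P [set x | X x = 1%N] = p%:E /\ P [set x | X x = 0%N] = (1 - p)%:E.

(* With q = 1 this is the unit mass at 0, since 0 ^+ 0 = 1. *)
Definition geometric_law (X : {RV P >-> nat}) (q : R) : Prop :=
  forall l : nat, P [set x | X x = l] = (q * (1 - q) ^+ l)%:E.

Definition q_geom (p u : R) : R := (u - p) / (u * (1 - p)).

Definition invariant_environment (p u : R) (w : nat * nat -> {RV P >-> nat}) :
    Prop :=
  [/\ mutually_independent w,
      forall i j : nat, bernoulli_law (w (i.+1, j.+1)) p,
      forall i : nat, bernoulli_law (w (i.+1, 0%N)) u,
      forall j : nat, geometric_law (w (0%N, j.+1)) (q_geom p u)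
    & forall x : T, w (0%N, 0%N) x = 0%N].

Definition G_inv (w : nat * nat -> {RV P >-> nat}) (m n : nat) (x : T) : nat :=
  boundary_last_passage (fun v => w v x) m n.

(* Num.truncn is the floor on nonnegative reals.  The value is +oo when the
   exponential moment is infinite. *)
Definition scaled_log_mgf (w : nat * nat -> {RV P >-> nat}) (s t xi : R)
    (N : nat) : \bar R :=
  ((N%:R^-1)%:E *
   lne 'E_P[fun x =>
     expR (xi * (G_inv w (Num.truncn (N%:R * s)) (Num.truncn (N%:R * t)) x)%:R)]
  )%E.

End Environment.

Section Cumulants.
Context (R : realType).
Implicit Types p q s t u xi : R.

Definition C_B u xi : R := ln (1 - u + u * expR xi).

(* lne sends 0 to -oo, so the domain of finiteness is the whole line if q = 1. *)
Definition C_G q xi : \bar R :=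
  if (xi%:E < - lne (1 - q)%:E)%E
  then (ln (q / (1 - (1 - q) * expR xi)))%:E else +oo%E.

(* The division is in \bar R, where a positive number divided by 0 is +oo:
   the threshold is +oo at u = 1. *)
Definition xi_max p u : \bar R :=
  lne ((u * (1 - p))%:E / (p * (1 - u))%:E)%E.

(* The quotient is 0 / 0 (equal to 0 in \bar R) when xi = 0 or u = 1; the first
   two cases of Lambda give the same value there. *)
Definition ell p u xi : \bar R :=
  ((C_B u xi + C_B u (- xi))%:E /
   (C_G (q_geom p u) xi + C_G (q_geom p u) (- xi)))%E.

Definition Lambda p u s t xi : \bar R :=
  (if xi%:E < xi_max p u then
     if t%:E < ell p u xi * s%:E
     then (s * C_B u xi)%:E - t%:E * C_G (q_geom p u) (- xi)
     else t%:E * C_G (q_geom p u) xi - (s * C_B u (- xi))%:E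
   else +oo)%E.

End Cumulants.

(* Main.v *)
Require Import Defs.
From HB Require Import structures.
From mathcomp Require Import all_boot all_order all_algebra.
From mathcomp Require Import all_classical all_reals all_analysis.
From mathcomp Require Import measurable_realfun zify ring lra.

Set Implicit Arguments.
Unset Strict Implicit.
Unset Printing Implicit Defensive.

Import Order.TTheory GRing.Theory Num.Theory.
Import numFieldNormedType.Exports.

Local Open Scope classical_set_scope.
Local Open Scope ring_scope.

(** The exponential moment of G is explicit when the two boundary laws are
    mismatched in the right way, and the stationary model is squeezed between
    such explicit values.

    Call a Bernoulli parameter u and a geometric parameter q coupled when
    q = (u - p) / (u (1 - p)).  If both boundaries have coupled laws, then the
    increments of G along any down-right path are independent, with the boundary
    laws (burke_cell, burke_row).  Now write G at (m, n) as the sum of the bottom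
    weights and of the increments up the right edge.  In the expectation of
    exp (xi G), the bottom sum tilts Bernoulli(u) to Bernoulli(u') at the cost of a
    factor exp (m C_B(xi)).  If the left weights had the law coupled to u' instead
    of u, the increments on the right edge would be independent, and the moment
    would be A = exp (m C_B(xi) - n C_G(- xi)) (horizontal_moment).  Writing G as
    the sum of the left weights and of the increments along the top gives in the
    same way, with the bottom law coupled to the tilted left law,
    B = exp (n C_G(xi) - m C_B(- xi)) (vertical_moment).

    For xi >= 0 the true left law is stochastically larger than the coupled one in
    the first computation, and so is the true bottom law in the second.  The
    increments on the right edge rise with the left weights, and those along the
    top rise with the bottom weights.  Hence the true moment is at least A and at
    least B (horizontal_moment_le, vertical_moment_le).

    Conversely G is the maximum of the best path leaving along the bottom axis and
    the best path leaving along the left axis.  The former does not read the left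
    weights, so their law may be replaced by the coupled one, and its moment is at
    most A; symmetrically the moment of the latter is at most B.  Hence the true
    moment is at most A + B (exp_moment_le_sum).

    For xi < xi_max these bounds hold at every (m, n), so N^-1 log of the moment
    converges to the larger of the two rates (cvg_scaled_lne), and ell records
    which one is larger (LambdaE).  For xi >= xi_max one geometric weight on the
    left axis already has an infinite moment, which decides the case t > 0; when
    t = 0, only the Bernoulli weights of the bottom axis are summed. *)

(** * The growth recursion *)

Section Growth.
Local Open Scope nat_scope.
Implicit Types (w : vertex -> nat) (v z : vertex) (bs : seq bool).

(** The passage time as a recursion over the last step of the path.  In this form
    its increments along a row can be computed cell by cell, which is what the
    Burke property acts on. *)
Fixpoint growth w (i : nat) : nat -> nat :=
  if i is i'.+1 then
    fix column j :=
      if j is j'.+1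
      then maxn (growth w i' j'.+1 + w (i'.+1, j'.+1)) (column j')
      else growth w i' 0 + w (i'.+1, 0)
  else fun j => \sum_(1 <= k < j.+1) w (0, k).

Lemma growth_step_true w i j : growth w i j + w (i.+1, j) <= growth w i.+1 j.
Proof. by case: j => [|j] //=; rewrite leq_maxl. Qed.

Lemma growth_step_false w i j : growth w i j <= growth w i j.+1.
Proof.
case: i => [|i] /=; last exact: leq_maxr.
by rewrite [leqRHS]big_nat_recr //= leq_addr.
Qed.

(** Each step of a path raises the recursion by at least the weight that the step
    collects, so these inequalities telescope. *)
Lemma growth_path w v bs :
  growth w v.1 v.2 + path_weight w v bs <=
  growth w (path_end v bs).1 (path_end v bs).2.
Proof.
elim: bs v => [|b bs IH] v /=; first by rewrite addn0.
rewrite addnA; apply: leq_trans (IH (step v b)); rewrite leq_add2r.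
by case: b; rewrite ?addn0 (growth_step_true, growth_step_false).
Qed.

Lemma growth_le w i j i' j' :
  i <= i' -> j <= j' -> growth w i j <= growth w i' j'.
Proof.
move=> ii' jj'; apply: (@leq_trans (growth w i' j)).
- rewrite -(subnKC ii'); elim: (i' - i) => [|k IH]; first by rewrite addn0.
  rewrite addnS; apply: leq_trans IH _.
  exact: leq_trans (leq_addr _ _) (growth_step_true _ _ _).
- rewrite -(subnKC jj'); elim: (j' - j) => [|k IH]; first by rewrite addn0.
  rewrite addnS; apply: leq_trans IH _; exact: growth_step_false.
Qed.

Lemma growth_last_passage w v z : v.1 <= z.1 -> v.2 <= z.2 ->
  growth w v.1 v.2 + last_passage w v z <= growth w z.1 z.2.
Proof.
move=> v1 v2; rewrite -leq_subRL; last exact: growth_le.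
apply/bigmax_leqP => bs /eqP bsz; rewrite leq_subRL; last exact: growth_le.
by have := growth_path w v bs; rewrite bsz.
Qed.

Lemma path_end_size v bs : let z := path_end v bs in
  [/\ v.1 <= z.1, v.2 <= z.2 & size bs = (z.1 - v.1) + (z.2 - v.2)].
Proof.
elim: bs v => [|b bs IH] v /=; first by rewrite !subnn.
by have := IH (step v b); case: b => /= -[? ? ->]; split; lia.
Qed.

Lemma path_weight_le_last_passage w v z bs :
  path_end v bs = z -> path_weight w v bs <= last_passage w v z.
Proof.
move=> <-; have [_ _ /eqP sz] := path_end_size v bs.
exact: (@leq_bigmax_cond _ _ (fun t => path_weight w v (tval t)) (Tuple sz)).
Qed.

Lemma path_weight_rcons w v bs b : path_weight w v (rcons bs b) =
  path_weight w v bs + (if b then w (step (path_end v bs) b) else 0).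
Proof.
elim: bs v => [|a bs IH] v /=; first by rewrite addn0.
by rewrite IH addnA.
Qed.

Lemma path_exists v z : v.1 <= z.1 -> v.2 <= z.2 ->
  exists bs, path_end v bs = z.
Proof.
case: v z => [a b] [c e] /= ac be.
exists (nseq (c - a) true ++ nseq (e - b) false).
rewrite /path_end foldl_cat.
have -> k i j : foldl step (i, j) (nseq k true) = (i + k, j).
  by elim: k i => [|k IH] i /=; rewrite ?addn0 // IH addSnnS.
have -> k i j : foldl step (i, j) (nseq k false) = (i, j + k).
  by elim: k j => [|k IH] j /=; rewrite ?addn0 // IH addSnnS.
by rewrite !subnKC.
Qed.

Lemma last_passage_extend w v z b : v.1 <= z.1 -> v.2 <= z.2 ->
  last_passage w v z + (if b then w (step z b) else 0)
  <= last_passage w v (step z b).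
Proof.
move=> v1 v2; set c := if b then _ else _; set X := last_passage w v (step z b).
have ext bs : path_end v bs = z -> path_weight w v bs + c <= X.
  move=> E; suff -> : path_weight w v bs + c = path_weight w v (rcons bs b).
    apply: path_weight_le_last_passage.
    by rewrite /path_end foldl_rcons; congr (step _ b).
  by rewrite path_weight_rcons E.
have cX : c <= X.
  by have [bs /ext] := path_exists v1 v2; apply: leq_trans; exact: leq_addl.
rewrite addnC -leq_subRL //.
by apply/bigmax_leqP => bs /eqP /ext; rewrite leq_subRL // addnC.
Qed.

(** The passage time splits according to the axis along which the path leaves the
    origin.  The horizontal half does not read the weights of the left axis and
    the vertical half does not read those of the bottom axis, so in each half one
    of the two boundary laws can be changed at will.  The value 0 stands for an
    empty set of paths. *)
Definition horizontal_passage w (m n : nat) : nat :=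
  match m, n with
  | _, 0 => \sum_(1 <= i < m.+1) w (i, 0)
  | 0, _ => 0
  | _, _ => \max_(1 <= k < m.+1)
      ((\sum_(1 <= i < k.+1) w (i, 0)) + last_passage w (k, 1) (m, n))
  end.

Definition vertical_passage w (m n : nat) : nat :=
  match m, n with
  | _, 0 => 0
  | 0, _ => \sum_(1 <= j < n.+1) w (0, j)
  | _, _ => \max_(1 <= k < n.+1)
      ((\sum_(1 <= j < k.+1) w (0, j)) + w (1, k)
         + last_passage w (1, k) (m, n))
  end.

Lemma boundary_last_passageE w m n : boundary_last_passage w m n =
  maxn (horizontal_passage w m n) (vertical_passage w m n).
Proof. by case: m n => [|m] [|n] //=; rewrite ?maxn0 ?max0n. Qed.

Lemma growth_bottom w i : growth w i 0 = \sum_(1 <= k < i.+1) w (k, 0).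
Proof.
elim: i => [|i IH] /=; first by rewrite !big_geq.
by rewrite [RHS]big_nat_recr //= IH.
Qed.

Lemma bigmax_nat_leP (a b M : nat) (F : nat -> nat) :
  (forall k, a <= k < b -> F k <= M) -> \max_(a <= k < b) F k <= M.
Proof.
move=> H; rewrite big_nat_cond; elim/big_ind: _ => // [x y|i].
  by rewrite geq_max => -> ->.
by rewrite andbT => /H.
Qed.

Lemma leq_bigmax_nat (a b k X : nat) (F : nat -> nat) :
  a <= k < b -> X <= F k -> X <= \max_(a <= i < b) F i.
Proof.
move=> kab /leq_trans; apply; rewrite (bigD1_seq k) ?iota_uniq ?mem_index_iota //=.
exact: leq_maxl.
Qed.

Lemma horizontal_passage_le_growth w m n :
  horizontal_passage w m n <= growth w m n.
Proof.
case: m n => [|m] [|n] //; rewrite ?growth_bottom //.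
apply: bigmax_nat_leP => k /andP[k0 km]; rewrite -growth_bottom.
have /= H := @growth_last_passage w (k, 1) (m.+1, n.+1) km isT.
by apply: leq_trans H; rewrite leq_add2r growth_le.
Qed.

Lemma vertical_passage_le_growth w m n :
  vertical_passage w m n <= growth w m n.
Proof.
case: m n => [|m] [|n] //; apply: bigmax_nat_leP => k /andP[k0 kn].
have /= H := @growth_last_passage w (1, k) (m.+1, n.+1) isT kn.
apply: leq_trans H; rewrite leq_add2r; case: k k0 {kn} => // k _.
exact: (growth_step_true w 0 k.+1).
Qed.

Lemma bigmax_nat_add_leP (a b c M : nat) (F : nat -> nat) : a < b ->
  (forall k, a <= k < b -> F k + c <= M) -> \max_(a <= k < b) F k + c <= M.
Proof.
move=> ab H; have cM : c <= M.
  by apply: leq_trans (H a _); rewrite ?leqnn ?leq_addl.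
rewrite addnC -leq_subRL //; apply: bigmax_nat_leP => k /H.
by rewrite leq_subRL // addnC.
Qed.

Lemma boundary_step_true w m n :
  boundary_last_passage w m n.+1 + w (m.+1, n.+1)
  <= boundary_last_passage w m.+1 n.+1.
Proof.
case: m => [|m].
  rewrite [leqRHS]/= leq_max; apply/orP; right.
  by apply: (leq_bigmax_nat (k := n.+1)); rewrite ?leqnn ?leq_addr.
rewrite !boundary_last_passageE addn_maxl geq_max; apply/andP; split.
- apply: bigmax_nat_add_leP => // k /andP[k0 km].
  rewrite leq_max; apply/orP; left.
  apply: (leq_bigmax_nat (k := k)); first by rewrite k0 ltnW.
  rewrite -addnA leq_add2l.
  exact: (@last_passage_extend w (k, 1) (m.+1, n.+1) true km).
- apply: bigmax_nat_add_leP => // k /andP[k0 kn].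
  rewrite leq_max; apply/orP; right.
  apply: (leq_bigmax_nat (k := k)); first by rewrite k0.
  rewrite -addnA leq_add2l.
  exact: (@last_passage_extend w (1, k) (m.+1, n.+1) true isT kn).
Qed.

Lemma boundary_step_false w m n :
  boundary_last_passage w m.+1 n <= boundary_last_passage w m.+1 n.+1.
Proof.
case: n => [|n].
  rewrite [leqRHS]/= leq_max; apply/orP; left.
  by apply: (leq_bigmax_nat (k := m.+1)); rewrite ?leqnn ?leq_addr.
rewrite !boundary_last_passageE geq_max; apply/andP; split.
- apply: bigmax_nat_leP => // k /andP[k0 km].
  rewrite leq_max; apply/orP; left.
  apply: (leq_bigmax_nat (k := k)); first by rewrite k0.
  rewrite leq_add2l -[leqLHS]addn0.
  exact: (@last_passage_extend w (k, 1) (m.+1, n.+1) false km).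
- apply: bigmax_nat_leP => // k /andP[k0 kn].
  rewrite leq_max; apply/orP; right.
  apply: (leq_bigmax_nat (k := k)); first by rewrite k0 ltnW.
  rewrite leq_add2l -[leqLHS]addn0.
  exact: (@last_passage_extend w (1, k) (m.+1, n.+1) false isT kn).
Qed.

(** The bound from above telescopes along any path; the bound from below prolongs
    an optimal path to whichever predecessor realizes the recursion. *)
Lemma boundary_growth w m n : boundary_last_passage w m n = growth w m n.
Proof.
apply/eqP; rewrite eqn_leq; apply/andP; split.
  rewrite boundary_last_passageE geq_max.
  by rewrite horizontal_passage_le_growth vertical_passage_le_growth.
elim: m n => [|m IHm] n; first by case: n => // ; rewrite /= !big_geq.
elim: n => [|n IHn]; first by rewrite growth_bottom.
rewrite [leqLHS]/= geq_max; apply/andP; split.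
  by apply: leq_trans (boundary_step_true w m n); rewrite leq_add2r; apply: IHm.
exact: leq_trans IHn (boundary_step_false w m n).
Qed.

(** A region that up-right steps cannot leave contains every vertex that a path
    started inside it enters. *)
Lemma path_weight_congr w w' (S : pred vertex) v bs :
  (forall v b, S v -> S (step v b)) -> S v ->
  (forall v, S v -> w v = w' v) -> path_weight w v bs = path_weight w' v bs.
Proof.
move=> Sstep Sv ww'; elim: bs v Sv => //= b bs IH v Sv.
by rewrite (IH _ (Sstep _ b Sv)) ww' //; apply: Sstep.
Qed.

Lemma horizontal_passage_congr w w' m n :
  (forall v, 0 < v.1 -> w v = w' v) ->
  horizontal_passage w m n = horizontal_passage w' m n.
Proof.
move=> ww'.
have bot k : \sum_(1 <= i < k.+1) w (i, 0) = \sum_(1 <= i < k.+1) w' (i, 0).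
  by apply: eq_big_nat => i /andP[i0 _]; rewrite ww'.
case: m n => [|m] [|n] //=; apply: eq_big_nat => k /andP[k0 _].
rewrite bot; congr (_ + _); apply: eq_bigr => bs _.
by apply: (path_weight_congr _ (S := fun v => 0 < v.1)) => // v b;
  case: b => /= [_|].
Qed.

Lemma vertical_passage_congr w w' m n :
  (forall v, 0 < v.2 -> w v = w' v) ->
  vertical_passage w m n = vertical_passage w' m n.
Proof.
move=> ww'.
have lft k : \sum_(1 <= i < k.+1) w (0, i) = \sum_(1 <= i < k.+1) w' (0, i).
  by apply: eq_big_nat => i /andP[i0 _]; rewrite ww'.
case: m n => [|m] [|n] //=; apply: eq_big_nat => k /andP[k0 _].
rewrite lft ww' //; congr (_ + _); apply: eq_bigr => bs _.
by apply: (path_weight_congr _ (S := fun v => 0 < v.2)) => // v b;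
  case: b => /= [|_].
Qed.

(** * Propagation of increments through a row *)

(** Let a cell have increment I below it, increment J to its left and weight o.
    The recursion gives the increment max(o, I - J) above it and the positive part
    of J + o - I to its right, so that truncated subtraction is the right one in
    both places.  The increment J travels along the row while the row Is of lower
    increments is replaced by the upper one. *)
Fixpoint row_step (Is : seq nat) (J : nat) (ws : seq nat) : seq nat * nat :=
  match Is, ws with
  | a :: Is', o :: ws' =>
      let r := row_step Is' (J + o - a) ws' in
      (maxn o (a - J) :: r.1, r.2)
  | _, _ => ([::], J)
  end.

Lemma row_step_cons a Is J o ws : row_step (a :: Is) J (o :: ws) =
  (maxn o (a - J) :: (row_step Is (J + o - a) ws).1,
   (row_step Is (J + o - a) ws).2).
Proof. by []. Qed.

Lemma row_step_size Is J ws : size ws = size Is ->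
  size (row_step Is J ws).1 = size Is.
Proof.
by elim: Is J ws => [|a Is IH] J [|o ws] //= [] sz; rewrite IH.
Qed.

(** Both sides are the growth between two opposite corners of the row, once along
    the left and top edges and once along the bottom and right edges. *)
Lemma row_step_conserves Is J ws : size ws = size Is ->
  J + sumn (row_step Is J ws).1 = sumn Is + (row_step Is J ws).2.
Proof.
elim: Is J ws => [|a Is IH] J [|o ws] //=; first by rewrite addn0.
by move=> [] /(IH (J + o - a)) E; lia.
Qed.

(** In a cell, raising I or lowering J raises the increment above and lowers the
    one to the right.  These directions are compatible, so they propagate. *)
Lemma row_step_mono Is Is' J J' ws :
  all2 leq Is Is' -> J' <= J -> size ws = size Is ->
  all2 leq (row_step Is J ws).1 (row_step Is' J' ws).1 /\
  (row_step Is' J' ws).2 <= (row_step Is J ws).2.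
Proof.
elim: Is Is' J J' ws => [|a Is IH] [|a' Is'] J J' [|o ws] //=.
move=> /andP[aa' IsIs'] JJ' [] sz.
have [|H1 H2] := IH Is' (J + o - a) (J' + o - a') ws IsIs' _ sz; first lia.
by rewrite H1 H2 andbT; split => //; lia.
Qed.

Definition bottom_row w m := [seq w (i.+1, 0) | i <- iota 0 m].
Definition bulk_row w m j := [seq w (i.+1, j.+1) | i <- iota 0 m].
Definition increments w m j :=
  [seq growth w i.+1 j - growth w i j | i <- iota 0 m].

Lemma increments_bottom w m : increments w m 0 = bottom_row w m.
Proof. by apply: eq_map => i /=; rewrite addKn. Qed.

Lemma increments_sum w m j :
  growth w 0 j + sumn (increments w m j) = growth w m j.
Proof.
elim: m => [|m IH]; first by rewrite addn0.
rewrite /increments -{1}[m.+1]addn1 iotaD map_cat sumn_cat addnA IH add0n /=.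
by rewrite addn0 subnKC //; apply: (growth_le w (leqnSn m) (leqnn j)).
Qed.

Lemma increments_row w m j : increments w m j.+1 =
  (row_step (increments w m j) (w (0, j.+1)) (bulk_row w m j)).1.
Proof.
have -> : w (0, j.+1) = growth w 0 j.+1 - growth w 0 j.
  by rewrite /= [X in X - _]big_nat_recr //= addKn.
rewrite /increments /bulk_row; elim: m 0 => // m IH a.
rewrite [iota _ _]/= !map_cons row_step_cons.
have H1 := growth_le w (leqnSn a) (leqnn j).
have H2 := growth_le w (leqnn a) (leqnSn j).
have H3 : growth w a.+1 j.+1 =
  maxn (growth w a j.+1 + w (a.+1, j.+1)) (growth w a.+1 j) by [].
congr (_ :: _); first by lia.
by rewrite IH; congr (row_step _ _ _).1; lia.
Qed.

End Growth.

(** * Expectations under weights on the natural numbers *)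

Section WeightedSums.
Context {R : realType}.
Implicit Types (mu nu : nat -> R) (f g : nat -> \bar R).
Local Open Scope ereal_scope.

(** The total mass is left free because exponentially tilted laws are used
    before they are normalized. *)
Definition Ex mu f : \bar R := \sum_(k <oo) (mu k)%:E * f k.

Definition weights mu := forall k, (0 <= mu k)%R.

Definition prob_weights mu := weights mu /\ Ex mu (fun=> 1) = 1.

Lemma eq_Ex mu f g : (forall k, f k = g k) -> Ex mu f = Ex mu g.
Proof. by move=> fg; apply: eq_eseriesr => k _; rewrite fg. Qed.

Lemma Ex_ge0 mu f : weights mu -> (forall k, 0 <= f k) -> 0 <= Ex mu f.
Proof.
by move=> mu0 f0; apply: nneseries_ge0 => k _ _; rewrite mule_ge0 ?lee_fin.
Qed.

Lemma Ex_le mu f g : weights mu -> (forall k, 0 <= f k) ->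
  (forall k, f k <= g k) -> Ex mu f <= Ex mu g.
Proof.
move=> mu0 f0 fg; apply: lee_nneseries => k *; last first.
  by apply: lee_wpmul2l; rewrite ?lee_fin.
by rewrite mule_ge0 ?lee_fin.
Qed.

Lemma Ex_scale mu nu (c : R) (a : nat -> R) f :
  weights mu -> (forall k, 0 <= f k) ->
  (forall k, a k * nu k = c * mu k)%R ->
  Ex nu (fun k => (a k)%:E * f k) = c%:E * Ex mu f.
Proof.
move=> mu0 f0 E; rewrite /Ex -nneseriesZl => [|k _]; last first.
  by rewrite mule_ge0 ?lee_fin.
by apply: eq_eseriesr => k _; rewrite !muleA -!EFinM mulrC E.
Qed.

Lemma ExZl mu (c : R) f : weights mu -> (forall k, 0 <= f k) ->
  Ex mu (fun k => c%:E * f k) = c%:E * Ex mu f.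
Proof. by move=> mu0 f0; apply: (Ex_scale (a := fun=> c)). Qed.

Lemma ExC mu nu (F : nat -> nat -> \bar R) : weights mu -> weights nu ->
  (forall i j, 0 <= F i j) ->
  Ex mu (fun i => Ex nu (fun j => F i j)) =
  Ex nu (fun j => Ex mu (fun i => F i j)).
Proof.
move=> mu0 nu0 F0; rewrite /Ex.
under eq_eseriesr => i _.
  rewrite -nneseriesZl => [|j _]; last by rewrite mule_ge0 ?lee_fin.
  over.
rewrite nneseries_interchange => [|i j]; last first.
  by rewrite !mule_ge0 ?lee_fin.
apply: eq_eseriesr => j _; rewrite -nneseriesZl => [|i _]; last first.
  by rewrite mule_ge0 ?lee_fin.
by apply: eq_eseriesr => i _; rewrite muleCA.
Qed.

Lemma Ex_cst mu (c : \bar R) : prob_weights mu -> 0 <= c ->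
  Ex mu (fun=> c) = c.
Proof.
move=> [mu0 mu1]; case: c => [r| |] // r0.
  rewrite -[RHS]mule1 -mu1 -ExZl //.
  by apply: eq_Ex => k; rewrite mule1.
(* an infinite constant is seen as soon as one atom is charged *)
have [k muk] : exists k, mu k != 0%R.
  apply: contrapT => /forallNP H; move: mu1; rewrite /Ex eseries0.
    by move/esym/eqP; rewrite onee_eq0.
  by move=> k _ _; have /negP := H k; rewrite negbK => /eqP ->; rewrite mul0e.
rewrite /Ex (nneseries_pinfty (k := k)) //.
  by move=> i _; rewrite mule_ge0 ?lee_fin.
by rewrite gt0_muley // lte_fin lt_neqAle eq_sym muk mu0.
Qed.

(** Integrating out finitely many independent coordinates with a common law. *)
Fixpoint Exn mu (m : nat) (f : seq nat -> \bar R) : \bar R :=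
  if m is m'.+1 then Ex mu (fun k => Exn mu m' (fun s => f (k :: s)))
  else f [::].

Implicit Types F G : seq nat -> \bar R.

Lemma eq_Exn mu m F G : (forall s, size s = m -> F s = G s) ->
  Exn mu m F = Exn mu m G.
Proof.
elim: m F G => [|m IH] F G FG /=; first exact: FG.
by apply: eq_Ex => k; apply: IH => s sm; rewrite FG //= sm.
Qed.

Lemma Exn_ge0 mu m F : weights mu -> (forall s, 0 <= F s) -> 0 <= Exn mu m F.
Proof.
by move=> mu0; elim: m F => //= m IH F F0; apply: Ex_ge0 => // k; apply: IH.
Qed.

Lemma Exn_le mu m F G : weights mu -> (forall s, 0 <= F s) ->
  (forall s, size s = m -> F s <= G s) -> Exn mu m F <= Exn mu m G.
Proof.
move=> mu0; elim: m F G => [|m IH] F G F0 FG /=; first exact: FG.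
apply: Ex_le => // k; first exact: Exn_ge0.
by apply: IH => // s sm; rewrite FG //= sm.
Qed.

Lemma ExnC mu nu m (F : nat -> seq nat -> \bar R) : weights mu -> weights nu ->
  (forall i s, 0 <= F i s) ->
  Ex mu (fun i => Exn nu m (F i)) = Exn nu m (fun s => Ex mu (F^~ s)).
Proof.
move=> mu0 nu0; elim: m F => //= m IH F F0.
rewrite ExC // => [|i j]; last exact: Exn_ge0.
by apply: eq_Ex => k; rewrite IH.
Qed.

Lemma ExnZl mu m (c : R) F : weights mu -> (forall s, 0 <= F s) ->
  Exn mu m (fun s => c%:E * F s) = c%:E * Exn mu m F.
Proof.
move=> mu0; elim: m F => //= m IH F F0; rewrite -ExZl // => [|k]; last first.
  exact: Exn_ge0.
by apply: eq_Ex => k; rewrite IH.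
Qed.

(** Tilting a product law by the exponential of the sum tilts each factor, at the
    price of one normalizing constant per coordinate. *)
Lemma Exn_tilt mu nu (xi c : R) m F :
  weights mu -> weights nu -> (forall s, 0 <= F s) ->
  (forall k, expR (xi * k%:R) * nu k = c * mu k)%R ->
  Exn nu m (fun s => (expR (xi * (sumn s)%:R))%:E * F s)
  = (c ^+ m)%:E * Exn mu m F.
Proof.
move=> mu0 nu0 + E; elim: m F => [|m IH] F F0 /=.
  by rewrite mulr0 expR0.
under eq_Ex => k.
  rewrite (_ : Exn _ _ _ =
    (expR (xi * k%:R))%:E * ((c ^+ m)%:E * Exn mu m (fun s => F (k :: s)))).
    over.
  rewrite -IH // -ExnZl // => [|s]; last by rewrite mule_ge0 // lee_fin expR_ge0.
  by apply: eq_Exn => s _; rewrite natrD mulrDr expRD EFinM muleA.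
have H k : 0 <= Exn mu m (fun s => F (k :: s)) by exact: Exn_ge0.
under eq_Ex do rewrite muleCA.
rewrite ExZl // => [|k]; last by rewrite mule_ge0 ?lee_fin ?expR_ge0.
by rewrite (Ex_scale mu0 H E) muleA -EFinM exprSr.
Qed.

End WeightedSums.

(** * Bernoulli and geometric weights *)

Section Laws.
Context {R : realType}.
Implicit Types (a b p q xi : R) (f g : nat -> \bar R).

Definition bern a (k : nat) : R :=
  match k with 0 => 1 - a | 1 => a | _ => 0 end.

Definition geo q (l : nat) : R := q * (1 - q) ^+ l.

Lemma bern_weights a : 0 <= a <= 1 -> weights (bern a).
Proof. by move=> /andP[a0 a1] [|[|k]] //=; rewrite subr_ge0. Qed.

Lemma geo_weights q : 0 < q <= 1 -> weights (geo q).
Proof.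
move=> /andP[q0 q1] k; rewrite /geo mulr_ge0 ?exprn_ge0 ?subr_ge0 //.
exact: ltW.
Qed.

Lemma ExD (mu : nat -> R) f g : weights mu ->
  (forall k, 0 <= f k)%E -> (forall k, 0 <= g k)%E ->
  Ex mu (fun k => f k + g k)%E = (Ex mu f + Ex mu g)%E.
Proof.
move=> mu0 f0 g0; rewrite /Ex -nneseriesD; last 2 first.
- by move=> k *; rewrite mule_ge0 ?lee_fin.
- by move=> k *; rewrite mule_ge0 ?lee_fin.
by apply: eq_eseriesr => k _; rewrite ge0_muleDr.
Qed.

Lemma Ex_bern a f : 0 <= a <= 1 -> (forall k, 0 <= f k)%E ->
  Ex (bern a) f = ((1 - a)%:E * f 0%N + a%:E * f 1%N)%E.
Proof.
move=> ha f0; have b0 := bern_weights ha.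
rewrite /Ex (nneseries_split 0 2) => [|k _]; last by rewrite mule_ge0 ?lee_fin.
rewrite eseries0 => [|[|[|k]] //= _ _]; last by rewrite mul0e.
by rewrite adde0 !big_nat_recl // big_geq //= adde0.
Qed.

Lemma bern_prob a : 0 <= a <= 1 -> prob_weights (bern a).
Proof.
move=> ha; split; first exact: bern_weights.
by rewrite Ex_bern // !mule1 -EFinD subrK.
Qed.

Lemma geo_prob q : 0 < q <= 1 -> prob_weights (geo q).
Proof.
move=> hq; split; first exact: geo_weights.
have /andP[q0 q1] := hq; rewrite /Ex.
apply: cvg_lim => //.
have -> : (fun n => \sum_(0 <= k < n) (geo q k)%:E * 1)%E =
          EFin \o series (geometric q (1 - q)).
  apply/funext => n /=; rewrite /series /= -sumEFin; apply: eq_bigr => k _.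
  by rewrite mule1.
have -> : 1%E = (q * (1 - (1 - q))^-1)%:E :> \bar R.
  by congr (_%:E); field; rewrite opprB addrC subrK gt_eqF.
apply: cvg_EFin; first by near=> n.
apply: cvg_geometric_series; rewrite ger0_norm; lra.
Unshelve. all: by end_near. Qed.

(** Memorylessness: a geometric variable is 0 with probability q and otherwise
    starts afresh after one unit. *)
Lemma Ex_geo_recl q f : 0 < q <= 1 -> (forall k, 0 <= f k)%E ->
  Ex (geo q) f = (q%:E * f 0%N + (1 - q)%:E * Ex (geo q) (fun k => f k.+1))%E.
Proof.
move=> hq f0; have g0 := geo_weights hq.
have t0 k : (0 <= (geo q k)%:E * f k)%E by rewrite mule_ge0 ?lee_fin.
rewrite {1}/Ex nneseries_recl //; congr (_ + _)%E.
  by rewrite /geo expr0 mulr1.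
rewrite -nneseries_addn //.
rewrite -ExZl // /Ex; apply: eq_eseriesr => k _.
by rewrite addn1 muleA -EFinM /geo exprS mulrCA mulrA [_ * (1 - q)]mulrC mulrA.
Qed.

(** Moving the mass b - a from the smaller value to the larger one.  Both kinds of
    boundary law are compared through this. *)
Lemma convex_mono a b (x y : \bar R) : 0 <= a <= b -> b <= 1 ->
  (0 <= x)%E -> (x <= y)%E ->
  ((1 - a)%:E * x + a%:E * y <= (1 - b)%:E * x + b%:E * y)%E.
Proof.
move=> /andP[a0 ab] b1 x0 xy.
have -> : (1 - a)%:E = ((1 - b)%:E + (b - a)%:E)%E.
  by rewrite -EFinD; congr (_%:E); lra.
have -> : b%:E = ((b - a)%:E + a%:E)%E.
  by rewrite -EFinD; congr (_%:E); lra.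
rewrite !ge0_muleDl ?lee_fin ?subr_ge0 //.
rewrite -addeA leeD2l // leeD2r // lee_wpmul2l // lee_fin subr_ge0 //.
Qed.

Lemma Ex_bern_mono a b f : 0 <= a -> a <= b -> b <= 1 ->
  (forall k, 0 <= f k)%E -> (f 0%N <= f 1%N)%E ->
  (Ex (bern a) f <= Ex (bern b) f)%E.
Proof.
move=> a0 ab b1 f0 f01; rewrite !Ex_bern //; try (apply/andP; split; lra).
by apply: convex_mono => //; rewrite a0.
Qed.

(** The expectation of f (min J N) for J geometric, computed by memorylessness.
    Only N convex combinations are involved, so stochastic monotonicity in q
    follows by induction, and it passes to the limit. *)
Fixpoint truncated_geo q (N : nat) (f : nat -> \bar R) : \bar R :=
  if N is N'.+1
  then (q%:E * f 0%N + (1 - q)%:E * truncated_geo q N' (fun k => f k.+1))%E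
  else f 0%N.

Lemma truncated_geo_ge q N f : 0 < q <= 1 -> (forall k, 0 <= f k)%E ->
  {homo f : i j / (i <= j)%N >-> (i <= j)%E} ->
  (f 0%N <= truncated_geo q N f)%E.
Proof.
move=> hq; have /andP[q0 q1] := hq.
elim: N f => //= N IH f f0 fmono; have fS : (f 0%N <= f 1%N)%E by apply: fmono.
rewrite -[leLHS]mul1e (_ : 1%E = (q%:E + (1 - q)%:E)%E); last first.
  by rewrite -EFinD; congr (_%:E); lra.
rewrite ge0_muleDl ?lee_fin ?subr_ge0 ?(ltW q0) //.
rewrite leeD2l // lee_wpmul2l ?lee_fin ?subr_ge0 //; apply: le_trans fS _.
by apply: (IH (fun k => f k.+1)) => // a b ab; apply: fmono.
Qed.

Lemma truncated_geo_mono q r N f : 0 < q -> q <= r -> r <= 1 ->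
  (forall k, 0 <= f k)%E -> {homo f : i j / (i <= j)%N >-> (i <= j)%E} ->
  (truncated_geo r N f <= truncated_geo q N f)%E.
Proof.
move=> q0 qr r1; elim: N f => //= N IH f f0 fmono.
have fS : {homo (fun k => f k.+1) : i j / (i <= j)%N >-> (i <= j)%E}.
  by move=> a b ab; apply: fmono.
have hr : 0 < r <= 1 by apply/andP; split; lra.
have le1 := truncated_geo_ge N hr (fun k => f0 k.+1) fS.
have le2 : (f 0%N <= f 1%N)%E by apply: fmono.
have := @convex_mono (1 - r) (1 - q) (f 0%N)
  (truncated_geo r N (fun k => f k.+1)).
rewrite !subKr => H; apply: le_trans (H _ _ _ _) _ => //.
- by apply/andP; split; lra.
- by lra.
- exact: le_trans le2 le1.
rewrite leeD2l // lee_wpmul2l ?lee_fin ?subr_ge0 //; first by lra.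
by apply: IH => // k; apply: f0.
Qed.

Lemma partial_geo_le_truncated q N f : 0 < q <= 1 -> (forall k, 0 <= f k)%E ->
  (\sum_(0 <= k < N) (geo q k)%:E * f k <= truncated_geo q N f)%E.
Proof.
move=> /andP[q0 q1]; elim: N f => [|N IH] f f0 /=; first by rewrite big_geq.
rewrite big_nat_recl //= /geo expr0 mulr1 leeD2l //.
rewrite (eq_bigr (fun k => (1 - q)%:E * ((geo q k)%:E * f k.+1)))%E; last first.
  move=> k _; rewrite muleA -EFinM /geo exprS; congr (_%:E * _)%E; ring.
rewrite -ge0_sume_distrr => [|k _]; last first.
  by rewrite mule_ge0 // lee_fin geo_weights // q0.
rewrite lee_wpmul2l ?lee_fin ?subr_ge0 //; exact: IH.
Qed.

Lemma truncated_geo_le_Ex q N f : 0 < q <= 1 -> (forall k, 0 <= f k)%E ->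
  {homo f : i j / (i <= j)%N >-> (i <= j)%E} ->
  (truncated_geo q N f <= Ex (geo q) f)%E.
Proof.
move=> hq; elim: N f => [|N IH] f f0 fmono /=.
  rewrite -(Ex_cst (geo_prob hq) (f0 0%N)).
  by apply: Ex_le => //; [exact: geo_weights | move=> k; apply: fmono].
rewrite Ex_geo_recl // leeD2l // lee_wpmul2l ?lee_fin ?subr_ge0 //.
  by case/andP: hq.
by apply: IH => // a b ab; apply: fmono.
Qed.

Lemma Ex_geo_mono q r f : 0 < q -> q <= r -> r <= 1 -> (forall k, 0 <= f k)%E ->
  {homo f : i j / (i <= j)%N >-> (i <= j)%E} ->
  (Ex (geo r) f <= Ex (geo q) f)%E.
Proof.
move=> q0 qr r1 f0 fmono.
have hr : 0 < r <= 1 by apply/andP; split; lra.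
have hq : 0 < q <= 1 by apply/andP; split; lra.
apply: lime_le; first apply: is_cvg_nneseries => k _ _.
  by rewrite mule_ge0 // lee_fin geo_weights.
apply: nearW => N; apply: le_trans (partial_geo_le_truncated N hr f0) _.
apply: le_trans (truncated_geo_mono N q0 qr r1 f0 fmono) _.
exact: truncated_geo_le_Ex.
Qed.

(** * Burke property *)

(** The last equation says that q is (u - p) / (u (1 - p)) without dividing.  Both
    sides are probabilities: of I = 0 and o = 1, and of I = 1, o = 0 and J > 0. *)
Definition burke_parameters p u q :=
  [/\ 0 <= p <= 1, 0 <= u <= 1, 0 < q <= 1 &
      (1 - u) * p = u * (1 - p) * (1 - q)].

(** The pair of outgoing increments of a cell has the law of the incoming pair.
    Split on I and o: a nonzero o when I = 0 shifts J up, a zero o when I = 1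
    shifts it down, memorylessness undoes the shifts, and the relation between
    the parameters makes the masses match. *)
Lemma burke_cell p u q (g : nat -> nat -> \bar R) :
  burke_parameters p u q -> (forall i j, 0 <= g i j)%E ->
  Ex (bern u) (fun i => Ex (geo q) (fun j => Ex (bern p) (fun o =>
    g (maxn o (i - j)) (j + o - i)%N))) =
  Ex (bern u) (fun i => Ex (geo q) (g i)).
Proof.
move=> [hp hu hq E] g0; have q0 := geo_weights hq.
have [/andP[p0 p1] /andP[u0 u1] /andP[q_gt0 q1]] := And3 hp hu hq.
have Ex0 f : (forall k, 0 <= f k)%E -> (0 <= Ex (geo q) f)%E.
  by move=> f0; apply: Ex_ge0.
have cell0 f : (forall k, 0 <= f k)%E -> (forall (c : R),
    (0 <= c)%R -> forall k, 0 <= c%:E * f k)%E.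
  by move=> f0 c c0 k; rewrite mule_ge0.
have ExZD (c1 c2 : R) f1 f2 : 0 <= c1 -> 0 <= c2 -> (forall k, 0 <= f1 k)%E ->
    (forall k, 0 <= f2 k)%E -> Ex (geo q) (fun k => c1%:E * f1 k + c2%:E * f2 k)%E
    = (c1%:E * Ex (geo q) f1 + c2%:E * Ex (geo q) f2)%E.
  move=> c10 c20 f10 f20; rewrite ExD //; try exact: cell0.
  by rewrite !ExZl.
pose A := Ex (geo q) (g 0%N); pose B := Ex (geo q) (g 1%N).
pose B' := Ex (geo q) (fun j => g 1%N j.+1).
have A0 : (0 <= A)%E by apply: Ex0.
have B0 : (0 <= B)%E by apply: Ex0.
have B'0 : (0 <= B')%E by apply: Ex0.
have BE : B = (q%:E * g 1%N 0%N + (1 - q)%:E * B')%E.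
  by rewrite /B Ex_geo_recl.
rewrite !(Ex_bern hu) -/A -/B => [|k|k]; [|exact: Ex0|]; last first.
  by do 2 apply: Ex_ge0 => // ?; exact: bern_weights.
have -> : Ex (geo q) (fun j => Ex (bern p) (fun o =>
    g (maxn o (0 - j)) (j + o - 0)%N)) = ((1 - p)%:E * A + p%:E * B')%E.
  rewrite -ExZD ?subr_ge0 //; apply: eq_Ex => j; rewrite Ex_bern // !subn0 addn0.
  by rewrite addn1.
have -> : Ex (geo q) (fun j => Ex (bern p) (fun o =>
    g (maxn o (1 - j)) (j + o - 1)%N)) =
    ((1 - p)%:E * (q%:E * g 1%N 0%N + (1 - q)%:E * A) + p%:E * B)%E.
  have -> : (q%:E * g 1%N 0%N + (1 - q)%:E * A)%E =
      Ex (geo q) (fun j => g (1 - j)%N (j - 1)%N).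
    rewrite Ex_geo_recl //; congr (_ + _ * _)%E.
    by apply: eq_Ex => k; rewrite subn1.
  rewrite -ExZD ?subr_ge0 //; apply: eq_Ex => j; rewrite Ex_bern // addn0 max0n.
  by rewrite addnK; case: j.
set C := g 1%N 0%N in BE *; have C0 : (0 <= C)%E by apply: g0.
have m0 (c : R) (x : \bar R) : 0 <= c -> (0 <= x -> 0 <= c%:E * x)%E.
  by move=> c0 x0; rewrite mule_ge0.
have [p'0 u'0 q'0 q_0] : [/\ 0 <= 1 - p, 0 <= 1 - u, 0 <= 1 - q & 0 <= q].
  by split; lra.
have -> : (u%:E * B = (u * (1 - p))%:E * (q%:E * C + (1 - q)%:E * B')
                        + (u * p)%:E * B)%E.
  rewrite -BE -ge0_muleDl ?lee_fin ?mulr_ge0 //; congr (_ * _)%E.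
  by rewrite -EFinD; congr (_%:E); ring.
have -> : ((1 - u)%:E * A = ((1 - u) * (1 - p))%:E * A + ((1 - u) * p)%:E * A)%E.
  rewrite -ge0_muleDl ?lee_fin ?mulr_ge0 //; congr (_ * _)%E.
  by rewrite -EFinD; congr (_%:E); ring.
rewrite !ge0_muleDr ?m0 ?adde_ge0 //?m0//.
rewrite !muleA -!EFinM E.
(* the two sides differ by exchanging the terms in A and B' of equal mass *)
by rewrite [LHS](AC (2 * (2 * 1)) ((1 * 4) * ((3 * 2) * 5)))%AC.
Qed.

End Laws.

(** * Stationarity and monotonicity of the row operator *)

Section RowBurke.
Context {R : realType}.
Implicit Types (p u q xi : R) (mu nu : nat -> R) (F G : seq nat -> \bar R).
Local Open Scope ereal_scope.

(** Cells are crossed from left to right.  The law is a product, so the first cell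
    can be integrated first; it hands a fresh geometric J, independent of the new
    increment above it, to the remaining cells. *)
Lemma burke_row p u q m (F : seq nat -> nat -> \bar R) :
  burke_parameters p u q -> (forall Is J, 0 <= F Is J) ->
  Exn (bern u) m (fun Is => Ex (geo q) (fun J => Exn (bern p) m (fun ws =>
    F (row_step Is J ws).1 (row_step Is J ws).2))) =
  Exn (bern u) m (fun Is => Ex (geo q) (F Is)).
Proof.
move=> hb; have [hp hu hq _] := hb.
have p0 := bern_weights hp; have u0 := bern_weights hu.
have q0 := geo_weights hq.
elim: m F => [|m IH] F F0 //=.
transitivity (Ex (bern u) (fun i => Ex (geo q) (fun j => Ex (bern p) (fun o =>
    Exn (bern u) m (fun Is => Exn (bern p) m (fun ws =>
      F (maxn o (i - j)%N :: (row_step Is (j + o - i)%N ws).1)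
        (row_step Is (j + o - i)%N ws).2)))))).
  apply: eq_Ex => i; rewrite -ExnC // => [|j s]; last first.
    by apply: Ex_ge0 => // o; apply: Exn_ge0.
  apply: eq_Ex => j; rewrite -ExnC // => o s; exact: Exn_ge0.
rewrite (burke_cell hb (g := fun a b => Exn (bern u) m (fun Is =>
  Exn (bern p) m (fun ws => F (a :: (row_step Is b ws).1)
    (row_step Is b ws).2)))) => [|a b]; last first.
  by apply: Exn_ge0 => // s; apply: Exn_ge0.
apply: eq_Ex => i; rewrite -(IH (fun Is => F (i :: Is))) //.
by rewrite ExnC // => j s; apply: Exn_ge0.
Qed.

(** One row of the lattice as an operator on functions of its row of horizontal
    increments: nu weighs the increment entering from the left, and h the one
    leaving on the right. *)
Definition transfer p nu (h : nat -> R) F (Is : seq nat) : \bar R :=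
  Ex nu (fun J => Exn (bern p) (size Is) (fun ws =>
    (h (row_step Is J ws).2)%:E * F (row_step Is J ws).1)).

Lemma transfer_ge0 p nu h F Is : (0 <= p <= 1)%R -> weights nu ->
  (forall k, 0 <= h k)%R -> (forall s, 0 <= F s) -> 0 <= transfer p nu h F Is.
Proof.
move=> hp nu0 h0 F0; apply: Ex_ge0 => // J; apply: Exn_ge0.
  exact: bern_weights.
by move=> s; rewrite mule_ge0 ?lee_fin.
Qed.

Lemma transfer_iter_ge0 p nu h F n Is : (0 <= p <= 1)%R -> weights nu ->
  (forall k, 0 <= h k)%R -> (forall s, 0 <= F s) ->
  0 <= iter n (transfer p nu h) F Is.
Proof.
by move=> hp nu0 h0 F0; elim: n Is => // n IH Is; apply: transfer_ge0.
Qed.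

(** At stationarity the increment leaving on the right is geometric and
    independent of the upper row, so h contributes its own expectation z. *)
Lemma stationary_transfer p u q (h : nat -> R) (z : R) nu F m :
  burke_parameters p u q -> (forall k, 0 <= h k)%R -> prob_weights nu ->
  (forall k, h k * geo q k = z * nu k)%R -> (forall s, 0 <= F s) ->
  Exn (bern u) m (transfer p (geo q) h F) = z%:E * Exn (bern u) m F.
Proof.
move=> hb h0 nuP E F0; have [hp hu hq _] := hb.
have u0 := bern_weights hu.
transitivity (Exn (bern u) m (fun Is => Ex (geo q) (fun J => (h J)%:E * F Is))).
  rewrite -(burke_row _ hb (F := fun Is J => (h J)%:E * F Is)) => [|Is J];
    last by rewrite mule_ge0 ?lee_fin.
  by apply: eq_Exn => s sm; rewrite /transfer sm.
rewrite -ExnZl //; apply: eq_Exn => s _.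
by rewrite (Ex_scale (mu := nu) (c := z)) ?Ex_cst //; case: nuP.
Qed.

Lemma stationary_transfer_iter p u q (h : nat -> R) (z : R) nu F m n :
  burke_parameters p u q -> (forall k, 0 <= h k)%R -> prob_weights nu ->
  (forall k, h k * geo q k = z * nu k)%R -> (forall s, 0 <= F s) ->
  Exn (bern u) m (iter n (transfer p (geo q) h) F) =
  (z ^+ n)%:E * Exn (bern u) m F.
Proof.
move=> hb h0 nuP E F0; have [hp hu hq _] := hb.
elim: n => [|n IH]; first by rewrite expr0 mul1e.
rewrite iterS (stationary_transfer m hb h0 nuP E) => [|s]; last first.
  by apply: transfer_iter_ge0 => //; apply: geo_weights.
by rewrite IH muleA -EFinM exprS.
Qed.

Lemma eq_transfer_size p nu h F G Is : (forall s, size s = size Is -> F s = G s) ->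
  transfer p nu h F Is = transfer p nu h G Is.
Proof.
move=> FG; apply: eq_Ex => J; apply: eq_Exn => ws sz.
by rewrite FG // row_step_size.
Qed.

Definition exp_sum xi (Is : seq nat) : \bar R := (expR (xi * (sumn Is)%:R))%:E.

Lemma exp_sum_ge0 xi Is : 0 <= exp_sum xi Is.
Proof. by rewrite lee_fin expR_ge0. Qed.

(** Since J + sum Is' = sum Is + J' over a row, the exponential of the left
    increments and of the top row may be traded for that of the bottom row and
    of the right increments. *)
Lemma transfer_exp_sum p nu nu' xi n Is : (0 <= p <= 1)%R -> weights nu ->
  (forall k, expR (xi * k%:R) * nu k = nu' k)%R ->
  iter n (transfer p nu' (fun=> 1%R)) (exp_sum xi) Is =
  exp_sum xi Is *
    iter n (transfer p nu (fun k => expR (xi * k%:R))) (fun=> 1) Is.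
Proof.
move=> hp nu0 E; have p0 := bern_weights hp.
elim: n Is => [|n IH] Is; first by rewrite mule1.
rewrite !iterS (eq_transfer_size _ _ _ (fun s _ => IH s)).
set F := iter n _ (fun=> 1); rewrite /transfer.
have F0 s : 0 <= F s.
  by apply: transfer_iter_ge0 => // k; apply: expR_ge0.
set G := fun J => Exn _ _ _; have G0 J : 0 <= G J.
  by apply: Exn_ge0 => // s; rewrite !mule_ge0 ?exp_sum_ge0.
have -> : Ex nu' G = Ex nu (fun J => (expR (xi * J%:R))%:E * G J).
  rewrite (Ex_scale (mu := nu') (c := 1%R)) ?mul1e // => k.
    by rewrite -E mulr_ge0 ?expR_ge0.
  by rewrite mul1r.
rewrite -ExZl // => [|J]; last first.
  by apply: Exn_ge0 => // s; rewrite mule_ge0 ?lee_fin ?expR_ge0.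
apply: eq_Ex => J; rewrite -!ExnZl //; last 2 first.
- by move=> s; rewrite !mule_ge0 ?exp_sum_ge0.
- by move=> s; rewrite mule_ge0 ?lee_fin ?expR_ge0.
apply: eq_Exn => ws sz; rewrite mul1e !muleA -!EFinM -!expRD -!mulrDr -!natrD.
by rewrite row_step_conserves.
Qed.

Definition nonincreasing_on (m : nat) F := forall s t,
  size s = m -> all2 leq s t -> F t <= F s.
Definition nondecreasing_on (m : nat) F := forall s t,
  size s = m -> all2 leq s t -> F s <= F t.

Lemma all2_leq_size s t : all2 leq s t -> size t = size s.
Proof. by elim: s t => [|a s IH] [|b t] //= /andP[_ /IH ->]. Qed.

Lemma all2_leq_refl s : all2 leq s s.
Proof. by elim: s => //= a s ->; rewrite leqnn. Qed.

(** The upper row rises with the lower one and the increment leaving on the right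
    falls, hence h has to be nondecreasing and F nonincreasing here. *)
Lemma transfer_nonincreasing p nu (h : nat -> R) F m :
  (0 <= p <= 1)%R -> weights nu -> (forall k, 0 <= h k)%R ->
  {homo h : i j / (i <= j)%N >-> (i <= j)%R} -> (forall s, 0 <= F s) ->
  nonincreasing_on m F -> nonincreasing_on m (transfer p nu h F).
Proof.
move=> hp nu0 h0 hmono F0 Fm s t sm st; rewrite /transfer (all2_leq_size st).
apply: Ex_le => // J.
  apply: Exn_ge0; first exact: bern_weights.
  by move=> ws; rewrite mule_ge0 ?lee_fin.
apply: Exn_le => [|ws|ws sz]; first exact: bern_weights.
  by rewrite mule_ge0 ?lee_fin.
have [H1 H2] := row_step_mono st (leqnn J) sz.
apply: lee_pmul; rewrite ?lee_fin ?h0 ?hmono //.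
by apply: Fm => //; rewrite row_step_size.
Qed.

Lemma transfer_nondecreasing p nu F m :
  (0 <= p <= 1)%R -> weights nu -> (forall s, 0 <= F s) ->
  nondecreasing_on m F -> nondecreasing_on m (transfer p nu (fun=> 1%R) F).
Proof.
move=> hp nu0 F0 Fm s t sm st; rewrite /transfer (all2_leq_size st).
apply: Ex_le => // J.
  apply: Exn_ge0; first exact: bern_weights.
  by move=> ws; rewrite mul1e.
apply: Exn_le => [|ws|ws sz]; first exact: bern_weights.
  by rewrite mul1e.
have [H1 _] := row_step_mono st (leqnn J) sz.
by rewrite !mul1e; apply: Fm => //; rewrite row_step_size.
Qed.

(** A larger J lowers the upper row and raises the increment on the right, so the
    integrand is nondecreasing in J, and J is stochastically decreasing in the
    parameter of its geometric law. *)
Lemma transfer_iter_geo_mono p q r (h : nat -> R) F m n :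
  (0 <= p <= 1)%R -> (0 < q)%R -> (q <= r)%R -> (r <= 1)%R ->
  (forall k, 0 <= h k)%R -> {homo h : i j / (i <= j)%N >-> (i <= j)%R} ->
  (forall s, 0 <= F s) -> nonincreasing_on m F ->
  forall s, size s = m ->
  iter n (transfer p (geo r) h) F s <= iter n (transfer p (geo q) h) F s.
Proof.
move=> hp q0 qr r1 h0 hmono F0 Fm.
have hr : (0 < r <= 1)%R by apply/andP; split; lra.
have hq : (0 < q <= 1)%R by apply/andP; split; lra.
have r0 := geo_weights hr; have p0 := bern_weights hp.
elim: n => // n IH s sm; rewrite !iterS.
set Gr := iter n _ F; set Gq := iter n _ F in IH *.
have Gr0 t : 0 <= Gr t by apply: transfer_iter_ge0.
have Gq0 t : 0 <= Gq t by apply: transfer_iter_ge0 => //; apply: geo_weights.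
have Grm : nonincreasing_on m Gr.
  by rewrite /Gr; elim: (n) => // k; apply: transfer_nonincreasing => //;
     move=> t; apply: transfer_iter_ge0.
apply: le_trans (_ : _ <= transfer p (geo q) h Gr s) _.
  apply: Ex_geo_mono => // [J|J J' JJ'].
    by apply: Exn_ge0 => // ws; rewrite mule_ge0 ?lee_fin.
  apply: Exn_le => // [ws|ws sz]; first by rewrite mule_ge0 ?lee_fin.
  have [H1 H2] := row_step_mono (all2_leq_refl s) JJ' sz.
  apply: lee_pmul; rewrite ?lee_fin ?h0 ?hmono //.
  by apply: Grm => //; rewrite row_step_size // (eqP sz).
apply: Ex_le => [|J|J]; first exact: geo_weights.
  by apply: Exn_ge0 => // ws; rewrite mule_ge0 ?lee_fin.
apply: Exn_le => // [ws|ws sz]; first by rewrite mule_ge0 ?lee_fin.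
by rewrite lee_wpmul2l ?lee_fin //; apply: IH; rewrite row_step_size.
Qed.

Lemma Exn_bern_mono a b m F : (0 <= a)%R -> (a <= b)%R -> (b <= 1)%R ->
  (forall s, 0 <= F s) -> nondecreasing_on m F ->
  Exn (bern a) m F <= Exn (bern b) m F.
Proof.
move=> a0 ab b1.
have wa : weights (bern a) by apply: bern_weights; apply/andP; split; lra.
have wb : weights (bern b) by apply: bern_weights; apply/andP; split; lra.
elim: m F => //= m IH F F0 Fm.
apply: le_trans (_ : _ <= Ex (bern a) (fun k => Exn (bern b) m (fun s => F (k :: s)))) _.
  apply: Ex_le => // k; first exact: Exn_ge0.
  by apply: IH => // s t sm st; apply: Fm; rewrite /= ?sm ?leqnn.
apply: Ex_bern_mono => // [k|]; first exact: Exn_ge0.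
apply: Exn_le => // s sm; apply: Fm; rewrite /= ?sm //.
exact: all2_leq_refl.
Qed.

End RowBurke.

(** * Integrating out the weights of finitely many vertices *)

Section Resampling.
Context {R : realType}.
Implicit Types (mu : vertex -> nat -> R) (w : vertex -> nat) (J : seq vertex)
  (F G : (vertex -> nat) -> \bar R).
Local Open Scope ereal_scope.

Definition update w (v : vertex) (k : nat) : vertex -> nat :=
  fun v' => if v' == v then k else w v'.

(** Integrates out the coordinates in J by overwriting them in w.  Keeping a full
    environment lets the same integrand be read in terms of paths, where it may
    ignore a boundary, and in terms of rows, where the transfer operator acts. *)
Fixpoint Ev mu J F w : \bar R :=
  if J is v :: J' then Ex (mu v) (fun k => Ev mu J' F (update w v k)) else F w.

Lemma Ev_cons mu v J F w :
  Ev mu (v :: J) F w = Ex (mu v) (fun k => Ev mu J F (update w v k)).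
Proof. by []. Qed.

Lemma Ev_cat mu J1 J2 F w :
  Ev mu (J1 ++ J2) F w = Ev mu J1 (Ev mu J2 F) w.
Proof. by elim: J1 w => //= v J1 IH w; apply: eq_Ex => k; apply: IH. Qed.

Lemma Ev_ge0 mu J F w : (forall v, weights (mu v)) -> (forall w', 0 <= F w') ->
  0 <= Ev mu J F w.
Proof. by move=> mu0 F0; elim: J w => //= v J IH w; apply: Ex_ge0. Qed.

Lemma Ev_le mu J F G w : (forall v, weights (mu v)) -> (forall w', 0 <= F w') ->
  (forall w', F w' <= G w') -> Ev mu J F w <= Ev mu J G w.
Proof.
move=> mu0 F0 FG; elim: J w => //= v J IH w; apply: Ex_le => // k.
exact: Ev_ge0.
Qed.

Lemma eq_Ev mu J F G w :
  (forall w', {in predC (mem J), w' =1 w} -> F w' = G w') ->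
  Ev mu J F w = Ev mu J G w.
Proof.
elim: J w => [|v J IH] w FG /=; first by apply: FG.
apply: eq_Ex => k; apply: IH => w' w'w; apply: FG => v'.
rewrite !inE negb_or => /andP[v'v v'J].
by rewrite w'w ?inE // /update (negbTE v'v).
Qed.

Lemma Ev_map mu (g : nat -> vertex) (nu : nat -> R) a m (f : seq nat -> \bar R) w :
  injective g -> (forall i, mu (g i) = nu) ->
  Ev mu [seq g i | i <- iota a m] (fun w' => f [seq w' (g i) | i <- iota a m]) w
  = Exn nu m f.
Proof.
move=> g_inj mu_g; elim: m a f w => //= m IH a f w; rewrite mu_g.
apply: eq_Ex => k; rewrite -(IH a.+1 (fun s => f (k :: s)) (update w (g a) k)).
apply: eq_Ev => w' w'w; rewrite w'w ?inE /update ?eqxx //.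
by rewrite mem_map // mem_iota ltnn.
Qed.

(** A probability law integrates to 1 along a coordinate that the integrand does
    not read, so any other probability law does as well. *)
Lemma Ev_irrelevant mu mu' (S : pred vertex) J F w :
  (forall v, ~~ S v -> mu v = mu' v) ->
  (forall v, prob_weights (mu v)) -> (forall v, prob_weights (mu' v)) ->
  (forall w', 0 <= F w') ->
  (forall w1 w2, {in predC S, w1 =1 w2} -> F w1 = F w2) ->
  Ev mu J F w = Ev mu' J F w.
Proof.
move=> mumu' pmu pmu' F0 FS.
have mu0 v : weights (mu v) by case: (pmu v).
have dep nu J' w1 w2 : {in predC S, w1 =1 w2} -> Ev nu J' F w1 = Ev nu J' F w2.
  elim: J' w1 w2 => [|v J' IH] w1 w2 w12 /=; first exact: FS.
  apply: eq_Ex => k; apply: IH => v' v'S; rewrite /update; case: eqP => // _.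
  exact: w12.
elim: J w => //= v J IH w; under eq_Ex do rewrite IH.
case: (boolP (S v)) => [Sv|/mumu' -> //].
have mu'0 v' : weights (mu' v') by case: (pmu' v').
have E k : Ev mu' J F (update w v k) = Ev mu' J F w.
  apply: dep => v' v'S; rewrite /update; case: eqP => // vv'.
  by move: v'S; rewrite !inE vv' Sv.
under eq_Ex do rewrite E.
under [RHS]eq_Ex do rewrite E.
by rewrite !Ex_cst // Ev_ge0.
Qed.

End Resampling.

(** * The boundary model *)

Section Model.
Context {R : realType}.
Implicit Types (p a u q xi : R) (nu : nat -> R) (w : vertex -> nat).
Local Open Scope ereal_scope.

Definition model p a nu (v : vertex) : nat -> R :=
  match v with
  | (0, _) => nu
  | (_.+1, 0) => bern a
  | (_.+1, _.+1) => bern p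
  end.

Lemma model_prob p a nu v : (0 <= p <= 1)%R -> (0 <= a <= 1)%R ->
  prob_weights nu -> prob_weights (model p a nu v).
Proof. by move=> hp ha hnu; case: v => [[|i] [|j]] //=; apply: bern_prob. Qed.

Definition bottom_vertices m : seq vertex := [seq (i.+1, 0%N) | i <- iota 0 m].
Definition bulk_vertices m j : seq vertex :=
  [seq (i.+1, j.+1) | i <- iota 0 m].

Fixpoint grid m n : seq vertex :=
  if n is j.+1 then grid m j ++ (0%N, j.+1) :: bulk_vertices m j
  else bottom_vertices m.

Lemma growth_congr w w' i j :
  (forall v, (v.1 <= i)%N -> (v.2 <= j)%N -> v != (0%N, 0%N) -> w v = w' v) ->
  growth w i j = growth w' i j.
Proof.
elim: i j => [|i IHi] j ww'.
  apply: eq_big_nat => k /andP[k0 kj]; apply: ww' => //.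
  by case: k k0 {kj}.
elim: j ww' => [|j IHj] ww' /=.
  by rewrite ww' // IHi // => v vi; apply: ww'; apply: leqW.
congr maxn; first rewrite ww' // IHi // => v vi; first by apply: ww'; apply: leqW.
by apply: IHj => v vi vj; apply: ww' => //; apply: leqW.
Qed.

Lemma increments_congr w w' m j : (forall v, (v.2 <= j)%N -> w v = w' v) ->
  increments w m j = increments w' m j.
Proof.
move=> ww'; apply: eq_map => i.
by rewrite !(growth_congr (w := w) (w' := w')) // => v _ vj _; apply: ww'.
Qed.

Lemma increments_size w m j : size (increments w m j) = m.
Proof. by rewrite size_map size_iota. Qed.

(** The rows below are frozen while row n+1 is integrated out.  The exponential of
    the new left weight is absorbed into the law of that weight. *)
Lemma Ev_row p a nu xi m n (F : seq nat -> \bar R) w :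
  (0 <= p <= 1)%R -> weights nu -> (forall s, 0 <= F s) ->
  Ev (model p a nu) ((0%N, n.+1) :: bulk_vertices m n) (fun w' =>
    (expR (xi * (growth w' 0 n.+1)%:R))%:E * F (increments w' m n.+1)) w =
  (expR (xi * (growth w 0 n)%:R))%:E *
    transfer p (fun k => expR (xi * k%:R) * nu k)%R (fun=> 1%R) F
      (increments w m n).
Proof.
move=> hp nu0 F0; rewrite Ev_cons [model p a nu _]/=.
have p0 := bern_weights hp; rewrite /transfer increments_size.
set c := expR _; set G := fun J => Exn _ _ _.
have G0 J : 0 <= G J by apply: Exn_ge0 => // s; rewrite mul1e.
have t0 : weights (fun k => expR (xi * k%:R) * nu k)%R.
  by move=> k; rewrite mulr_ge0 ?expR_ge0.
have -> : Ex (fun k => expR (xi * k%:R) * nu k)%R G =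
    Ex nu (fun k => (expR (xi * k%:R))%:E * G k).
  rewrite (Ex_scale (mu := (fun k => expR (xi * k%:R) * nu k)%R) (c := 1%R)) //.
    by rewrite mul1e.
  by move=> k; rewrite mul1r.
rewrite -ExZl // => [|k]; last by rewrite mule_ge0 ?lee_fin ?expR_ge0.
apply: eq_Ex => k.
rewrite -!ExnZl //; last 2 first.
- by move=> s; rewrite mule_ge0 ?mul1e ?lee_fin ?expR_ge0.
- by move=> s; rewrite mul1e.
rewrite -(@Ev_map _ (model p a nu) (fun i => (i.+1, n.+1)) (bern p) 0 m _
  (update w (0%N, n.+1) k)) //; last by move=> i j [].
apply: eq_Ev => w' w'w.
have w'E v : (v.2 <= n)%N -> w' v = w v.
  move=> vn; rewrite w'w /update ?inE; last first.
    by apply/mapP => -[i _ vE]; move: vn; rewrite vE ltnn.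
  by case: eqP vn => // ->; rewrite ltnn.
have w'k : w' (0%N, n.+1) = k.
  rewrite w'w /update ?eqxx // inE; apply/mapP => -[i _]; by [].
rewrite increments_row (increments_congr _ w'E) w'k -/(bulk_row w' m n).
have -> : growth w' 0 n.+1 = (growth w 0 n + k)%N.
  rewrite -(growth_congr (w := w')); last by move=> v _ vn _; apply: w'E.
  by rewrite /= big_nat_recr //= w'k.
by rewrite mul1e natrD mulrDr expRD EFinM muleA.
Qed.

(** Peeling off the top row turns the integrand into one of the same form with F
    replaced by its transfer. *)
Lemma Ev_grid p a nu xi m n (F : seq nat -> \bar R) w :
  (0 <= p <= 1)%R -> weights nu -> (forall s, 0 <= F s) ->
  Ev (model p a nu) (grid m n) (fun w' =>
    (expR (xi * (growth w' 0 n)%:R))%:E * F (increments w' m n)) w =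
  Exn (bern a) m
    (iter n (transfer p (fun k => expR (xi * k%:R) * nu k)%R (fun=> 1%R)) F).
Proof.
move=> hp nu0; elim: n F => [|n IH] F F0.
  rewrite [grid _ _]/= -(@Ev_map _ (model p a nu) (fun i => (i.+1, 0%N))
    (bern a) 0 m _ w) //; last by move=> i j [].
  apply: eq_Ev => w' _.
  by rewrite increments_bottom /growth big_geq // mulr0 expR0 mul1e.
rewrite [grid _ _]/= Ev_cat iterSr -IH.
  by apply: eq_Ev => w' _; apply: Ev_row.
move=> s; apply: transfer_ge0 => // k; by rewrite mulr_ge0 ?expR_ge0.
Qed.

Lemma Ev_growth p a nu xi m n w : (0 <= p <= 1)%R -> weights nu ->
  Ev (model p a nu) (grid m n) (fun w' =>
    (expR (xi * (growth w' m n)%:R))%:E) w =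
  Exn (bern a) m
    (iter n (transfer p (fun k => expR (xi * k%:R) * nu k)%R (fun=> 1%R))
       (exp_sum xi)).
Proof.
move=> hp nu0; rewrite -(Ev_grid a xi m n w hp nu0) => [|s]; last exact: exp_sum_ge0.
apply: eq_Ev => w' _; rewrite /exp_sum -EFinM -expRD -mulrDr -natrD.
by rewrite increments_sum.
Qed.

End Model.

(** * From the probability space to iterated sums *)

Section Linking.
Context {d : measure_display} {T : measurableType d} {R : realType}.
Context (P : probability T R) (w : vertex -> {RV P >-> nat}).
Implicit Types (J L : seq vertex) (F : (vertex -> nat) -> \bar R)
  (e : vertex -> nat) (mu : vertex -> nat -> R).
Local Open Scope ereal_scope.

Definition depends_on L F := forall e e', {in L, e =1 e'} -> F e = F e'.

Definition env (x : T) : vertex -> nat := fun v => w v x.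

Lemma measurable_level v k : measurable [set x | w v x = k].
Proof.
by apply: (@measurable_funPTI _ _ _ _ (w v) [set k]).
Qed.

(** Such a function has countably many pieces, one for each value of the weights
    that it reads. *)
Lemma measurable_env L F : depends_on L F -> measurable_fun setT (F \o env).
Proof.
elim: L F => [|v L IH] F dF.
  rewrite (_ : F \o env = cst (F (fun=> 0%N))); first exact: measurable_cst.
  by apply/funext => x; apply: dF.
pose G k := F \o (fun e => update e v k).
have mG k : measurable_fun setT (G k \o env).
  apply: IH => e e' ee'; apply: dF => v'; rewrite /update inE.
  by case: eqP => //= _; apply: ee'.
move=> _ Y mY; rewrite setTI.
rewrite (_ : _ @^-1` Y = \bigcup_k ([set x | w v x = k] `&` (G k \o env) @^-1` Y)).
  apply: bigcupT_measurable => k; apply: measurableI.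
    exact: measurable_level.
  by rewrite -[X in measurable X]setTI; apply: mG.
apply/seteqP; split => [x Yx|x [k _ [/= xk]]].
  exists (w v x) => //; split => //=.
  rewrite /G /= (_ : update _ _ _ = env x) //.
  by apply/funext => v'; rewrite /update; case: eqP => // ->.
rewrite /G /= (_ : update _ _ _ = env x) //.
by apply/funext => v'; rewrite /update; case: eqP => // ->.
Qed.

Definition agree J e : set T :=
  \bigcap_(v in [set` J]) (w v @^-1` [set e v]).

Lemma measurable_agree J e : measurable (agree J e).
Proof.
apply: fin_bigcap_measurable; first exact: finite_seq.
move=> v _; exact: measurable_level.
Qed.

Context (w_indep : mutually_independent w).

Lemma prob_agree mu J e : uniq J ->
  (forall v, v \in J -> forall k, P [set x | w v x = k] = (mu v k)%:E) ->
  P (agree J e) = (\prod_(v <- J) mu v (e v))%:E.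
Proof.
move=> uJ law; rewrite /agree (w_indep (fun v => [set e v]) uJ).
rewrite -prodEFin big_seq [RHS]big_seq; apply: eq_bigr => v vJ.
exact: law.
Qed.

(** Slice along the value of the next weight of L.  Working on the event that the
    weights of J have prescribed values is what makes the induction go through:
    once L is exhausted, the integrand is constant on that event. *)
Lemma integral_agree mu J L F e : uniq (J ++ L) -> depends_on (J ++ L) F ->
  (forall v, weights (mu v)) -> (forall e', 0 <= F e') ->
  (forall v, v \in J ++ L -> forall k, P [set x | w v x = k] = (mu v k)%:E) ->
  \int[P]_(x in agree J e) F (env x) = P (agree J e) * Ev mu L F e.
Proof.
elim: L J e => [|v L IH] J e uJL dF mu0 F0 law.
  rewrite (eq_integral (cst (F e))) => [|x]; last first.
    rewrite inE => xJ; apply: dF => v; rewrite cats0 => vJ; exact: xJ.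
  by rewrite integral_cst 1?muleC //; apply: measurable_agree.
have /= /andP[vJL uJL'] : uniq (v :: J ++ L).
  by rewrite -(perm_uniq (permEl (perm_catCA J [:: v] L))).
have uJ : uniq J by move: uJL'; rewrite cat_uniq => /and3P[].
have vJ : v \notin J by apply: contra vJL; rewrite mem_cat => ->.
have perm : perm_eq (J ++ v :: L) ((v :: J) ++ L).
  exact: permEl (perm_catCA J [:: v] L).
pose A k := agree (v :: J) (update e v k).
have AE k : A k = agree J e `&` [set x | w v x = k].
  apply/seteqP; split => x.
    move=> xA; split.
      move=> v' v'J; have := xA v'; rewrite /= inE v'J orbT => /(_ isT) ->.
      by rewrite /update; case: eqP => // vv'; move: vJ; rewrite -vv' [_ \in _]v'J.
    by have := xA v; rewrite /= inE eqxx => /(_ isT); rewrite /update eqxx.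
  move=> [xJ xk] v'; rewrite /= inE /update; case: eqP => [-> _ //|_ /= v'J].
  exact: xJ.
have AU : agree J e = \bigcup_k A k.
  apply/seteqP; split => [x xJ|x [k _]]; last by rewrite AE => -[].
  by exists (w v x) => //; rewrite AE.
have tA : trivIset setT A.
  apply/trivIsetP => i j _ _ ij; apply/seteqP; split => // x [].
  by rewrite !AE => -[_ /= xi] [_ /= xj]; move: ij; rewrite -xi -xj eqxx.
have mF : measurable_fun setT (F \o env) by apply: measurable_env dF.
rewrite {1}AU ge0_integral_bigcup //; first last.
- by apply: measurable_funS mF => //; rewrite -AU; apply: measurable_agree.
- by move=> k; apply: measurable_agree.
rewrite (prob_agree (mu := mu)) //; last first.
  by move=> v' v'J; apply: law; rewrite mem_cat v'J.
set c := (\prod_(v' <- J) _)%R; rewrite -ExZl //; last by move=> k; apply: Ev_ge0.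
apply: eq_eseriesr => k _; rewrite IH //.
- rewrite (prob_agree (mu := mu)) //=; last 2 first.
  + by rewrite vJ uJ.
  + by move=> v' v'J; apply: law; rewrite (perm_mem perm) mem_cat v'J.
  rewrite big_cons {1}/update eqxx muleA -EFinM; congr (_%:E * _).
  congr *%R; rewrite /c big_seq [RHS]big_seq; apply: eq_bigr => v' v'J.
  by rewrite /update; case: eqP => // vv'; move: vJ; rewrite -vv' v'J.
- by rewrite -(perm_uniq perm).
- by move=> e1 e2 e12; apply: dF => v'; rewrite (perm_mem perm); apply: e12.
- by move=> v'; rewrite -(perm_mem perm); apply: law.
Qed.

Lemma expectation_env mu L F e : uniq L -> depends_on L F ->
  (forall v, weights (mu v)) -> (forall e', 0 <= F e') ->
  (forall v, v \in L -> forall k, P [set x | w v x = k] = (mu v k)%:E) ->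
  \int[P]_x F (env x) = Ev mu L F e.
Proof.
move=> uL dF mu0 F0 law.
have := integral_agree (J := [::]) e uL dF mu0 F0 law.
have -> : agree [::] e = setT by apply/seteqP; split => // x _ v.
by rewrite probability_setT mul1e.
Qed.

End Linking.

(** * Exponential tilting of the boundary *)

Section Tilting.
Context {R : realType}.
Implicit Types (p u q xi : R) (F : seq nat -> \bar R).

Definition bern_mgf u xi : R := 1 - u + u * expR xi.
Definition tilt_bern u xi : R := u * expR xi / bern_mgf u xi.
Definition tilt_geo q xi : R := 1 - (1 - q) * expR xi.

Lemma bern_mgf_gt0 u xi : 0 <= u <= 1 -> 0 < bern_mgf u xi.
Proof.
move=> /andP[u0 u1]; have e0 := expR_gt0 xi; rewrite /bern_mgf.
have [u_gt0|u_le0] := ltP 0 u; last by have -> : u = 0; lra.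
by apply: ltr_wpDl; [lra|exact: mulr_gt0].
Qed.

Lemma bern_tilt u xi k : 0 <= u <= 1 ->
  expR (xi * k%:R) * bern u k = bern_mgf u xi * bern (tilt_bern u xi) k.
Proof.
move=> /(bern_mgf_gt0 xi)/gt_eqF/negbT Z0.
case: k => [|[|k]] /=; rewrite ?mulr0 //.
  by rewrite expR0 mul1r /tilt_bern; move: Z0; rewrite /bern_mgf => Z0; field.
by rewrite mulr1 /tilt_bern; field.
Qed.

Lemma bern_untilt u xi k : 0 <= u <= 1 ->
  expR (xi * k%:R) * bern (tilt_bern u (- xi)) k =
  (bern_mgf u (- xi))^-1 * bern u k.
Proof.
move=> hu; have Z0 := bern_mgf_gt0 (- xi) hu.
have -> : bern u k =
    expR (xi * k%:R) * (bern_mgf u (- xi) * bern (tilt_bern u (- xi)) k).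
  by rewrite -bern_tilt // mulrA -expRD mulNr subrr expR0 mul1r.
by rewrite mulrCA mulKf // gt_eqF.
Qed.

Lemma geo_tilt q xi k : (1 - q) * expR xi < 1 ->
  expR (xi * k%:R) * geo q k = q / tilt_geo q xi * geo (tilt_geo q xi) k.
Proof.
move=> lt1; have t0 : tilt_geo q xi != 0 by rewrite /tilt_geo; lra.
rewrite /geo; have -> : 1 - tilt_geo q xi = (1 - q) * expR xi.
  by rewrite /tilt_geo opprB addrC subrK.
by rewrite exprMn -expRM_natl [k%:R * _]mulrC; field.
Qed.

Lemma geo_untilt q xi k : 0 < q -> (1 - q) * expR (- xi) < 1 ->
  expR (xi * k%:R) * geo (tilt_geo q (- xi)) k =
  tilt_geo q (- xi) / q * geo q k.
Proof.
move=> q0 lt1; have t0 : tilt_geo q (- xi) != 0 by rewrite /tilt_geo; lra.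
have -> : geo q k = expR (xi * k%:R) *
    (q / tilt_geo q (- xi) * geo (tilt_geo q (- xi)) k).
  by rewrite -geo_tilt // mulrA -expRD mulNr subrr expR0 mul1r.
by field; rewrite t0 gt_eqF.
Qed.

Lemma tilt_bern_itv u xi : 0 <= u <= 1 -> 0 <= tilt_bern u xi <= 1.
Proof.
move=> hu; have Z0 := bern_mgf_gt0 xi hu; move/andP: hu => [u0 u1].
have e0 := expR_ge0 xi; apply/andP; split.
  by rewrite divr_ge0 ?mulr_ge0 // ltW.
by rewrite ler_pdivrMr // mul1r /bern_mgf; lra.
Qed.

Lemma tilt_geo_itv q xi : q <= 1 -> (1 - q) * expR xi < 1 ->
  0 < tilt_geo q xi <= 1.
Proof.
move=> q1 lt1; have := mulr_ge0 (_ : 0 <= 1 - q) (expR_ge0 xi).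
by rewrite /tilt_geo => H; apply/andP; split; [lra|have := H _; lra].
Qed.

(** Tilting by xi on the Bernoulli side and by - xi on the geometric side multiplies
    both (1 - u) / u and 1 - q by exp (- xi), which preserves their relation. *)
Lemma burke_tilt p u q xi : burke_parameters p u q ->
  (1 - q) * expR (- xi) < 1 ->
  burke_parameters p (tilt_bern u xi) (tilt_geo q (- xi)).
Proof.
move=> [hp hu hq E] lt1; split => //.
- exact: tilt_bern_itv.
- by apply: tilt_geo_itv => //; case/andP: hq.
have := bern_mgf_gt0 xi hu; rewrite /tilt_geo /tilt_bern expRN.
have /gt_eqF/negbT e0 := expR_gt0 xi.
move=> /gt_eqF/negbT Z0.
have -> : 1 - (1 - (1 - q) / expR xi) = (1 - q) / expR xi by ring.
have -> : 1 - u * expR xi / bern_mgf u xi = (1 - u) / bern_mgf u xi.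
  by move: Z0; rewrite /bern_mgf => Z0; field.
by rewrite mulrAC E; field; rewrite e0.
Qed.

Lemma tilt_bern_le u xi : 0 <= u <= 1 -> xi <= 0 -> tilt_bern u xi <= u.
Proof.
move=> hu xi0; rewrite ler_pdivrMr ?bern_mgf_gt0 // /bern_mgf.
have e1 : expR xi <= 1 by rewrite -expR0 ler_expR.
move/andP: hu => [u0 u1].
have : 0 <= u * (1 - u) * (1 - expR xi) by rewrite !mulr_ge0 ?subr_ge0.
lra.
Qed.

Lemma tilt_geo_ge q xi : q <= 1 -> xi <= 0 -> q <= tilt_geo q xi.
Proof.
move=> q1 xi0; rewrite /tilt_geo.
have e1 : expR xi <= 1 by rewrite -expR0 ler_expR.
have : 0 <= (1 - q) * (1 - expR xi) by rewrite !mulr_ge0 ?subr_ge0.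
lra.
Qed.

Local Open Scope ereal_scope.

Lemma transfer_scale p (nu nu' : nat -> R) (c : R) h F Is :
  (0 <= p <= 1)%R -> weights nu' -> (forall k, 0 <= h k)%R ->
  (forall s, 0 <= F s) -> (forall k, nu k = c * nu' k)%R ->
  transfer p nu h F Is = c%:E * transfer p nu' h F Is.
Proof.
move=> hp nu'0 h0 F0 E.
rewrite -(Ex_scale (nu := nu) (a := fun=> 1%R)) //.
- by apply: eq_Ex => J; rewrite mul1e.
- move=> J; apply: Exn_ge0; first exact: bern_weights.
  by move=> s; rewrite mule_ge0 ?lee_fin.
- by move=> k; rewrite mul1r.
Qed.

Lemma transferZl p nu (c : R) h F Is : (0 <= p <= 1)%R -> weights nu ->
  (forall k, 0 <= h k)%R -> (forall s, 0 <= F s) ->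
  transfer p nu h (fun s => c%:E * F s) Is = c%:E * transfer p nu h F Is.
Proof.
move=> hp nu0 h0 F0; have p0 := bern_weights hp; rewrite /transfer -ExZl //.
  apply: eq_Ex => J; rewrite -ExnZl // => [|s].
    by apply: eq_Exn => s _; rewrite muleCA.
  by rewrite mule_ge0 ?lee_fin.
by move=> J; apply: Exn_ge0 => // s; rewrite mule_ge0 ?lee_fin.
Qed.

Lemma transfer_iter_scale p (nu nu' : nat -> R) (c : R) h F n Is :
  (0 <= p <= 1)%R -> weights nu' -> (0 <= c)%R -> (forall k, 0 <= h k)%R ->
  (forall s, 0 <= F s) -> (forall k, nu k = c * nu' k)%R ->
  iter n (transfer p nu h) F Is = (c ^+ n)%:E * iter n (transfer p nu' h) F Is.
Proof.
move=> hp nu'0 c0 h0 F0 E; elim: n Is => [|n IH] Is; first by rewrite mul1e.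
rewrite !iterS (eq_transfer_size _ _ _ (fun s _ => IH s)).
have G0 s : 0 <= iter n (transfer p nu' h) F s by apply: transfer_iter_ge0.
rewrite (transfer_scale (nu' := nu') (c := c)) // => [|s]; last first.
  by rewrite mule_ge0 ?lee_fin ?exprn_ge0.
by rewrite transferZl // muleA -EFinM exprS.
Qed.

(** The expectation of exp (xi G) when the bottom weights are Bernoulli(a) and the
    left weights have law nu, in the row by row form of Ev_growth.  The two
    boundary laws need not be the ones that the Burke property couples. *)
Definition exp_moment p a (nu : nat -> R) xi m n : \bar R :=
  Exn (bern a) m
    (iter n (transfer p (fun k => expR (xi * k%:R) * nu k)%R (fun=> 1%R))
       (exp_sum xi)).

Lemma exp_monoR xi : (0 <= xi)%R ->
  {homo (fun k => expR (xi * k%:R)) : i j / (i <= j)%N >-> (i <= j)%R}.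
Proof. by move=> xi0 i j ij; rewrite ler_expR ler_wpM2l ?ler_nat. Qed.

(** G is the sum of the bottom weights and of the right increments; the former are
    absorbed by tilting. *)
Lemma exp_moment_right p a (nu : nat -> R) xi m n :
  (0 <= p <= 1)%R -> (0 <= a <= 1)%R -> weights nu ->
  exp_moment p a nu xi m n = (bern_mgf a xi ^+ m)%:E *
    Exn (bern (tilt_bern a xi)) m
      (iter n (transfer p nu (fun k => expR (xi * k%:R))%R) (fun=> 1)).
Proof.
move=> hp ha nu0; rewrite /exp_moment.
rewrite -(Exn_tilt (nu := bern a) (xi := xi)).
- by apply: eq_Exn => s _; rewrite (transfer_exp_sum (nu := nu)).
- by apply: bern_weights; apply: tilt_bern_itv.
- exact: bern_weights.
- by move=> s; apply: transfer_iter_ge0 => // k; apply: expR_ge0.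
- by move=> k; apply: bern_tilt.
Qed.

(** G is also the sum of the left weights and of the increments along the top; here
    the left weights are tilted. *)
Lemma exp_moment_left p a q xi m n :
  (0 <= p <= 1)%R -> (0 <= a <= 1)%R -> (0 < q <= 1)%R ->
  ((1 - q) * expR xi < 1)%R ->
  exp_moment p a (geo q) xi m n = ((q / tilt_geo q xi) ^+ n)%:E *
    Exn (bern a) m
      (iter n (transfer p (geo (tilt_geo q xi)) (fun=> 1%R)) (exp_sum xi)).
Proof.
move=> hp ha hq lt1; have /andP[q0 q1] := hq.
have ht := tilt_geo_itv q1 lt1; have /andP[t0 _] := ht.
rewrite /exp_moment -ExnZl; last 2 first.
- exact: bern_weights.
- move=> s; apply: transfer_iter_ge0 => //; first exact: geo_weights.
  by move=> s'; apply: exp_sum_ge0.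
apply: eq_Exn => s _; apply: transfer_iter_scale => //.
- exact: geo_weights.
- by rewrite divr_ge0 // ltW.
- by move=> s'; apply: exp_sum_ge0.
- by move=> k; apply: geo_tilt.
Qed.

Lemma Exn_cst1 (mu : nat -> R) m : prob_weights mu -> Exn mu m (fun=> 1) = 1.
Proof.
move=> mu1; elim: m => //= m IH; under eq_Ex do rewrite IH.
by rewrite Ex_cst.
Qed.

(** The left law is chosen to be the one coupled to the tilted bottom law.  After
    tilting the model is stationary, and the right increments are independent. *)
Lemma horizontal_moment p u q xi m n : burke_parameters p u q -> 
  ((1 - q) * expR (- xi) < 1)%R ->
  exp_moment p u (geo (tilt_geo q (- xi))) xi m n =
  (bern_mgf u xi ^+ m * (tilt_geo q (- xi) / q) ^+ n)%:E.
Proof.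
move=> hb lt1; have [hp hu hq E] := hb; have /andP[q0 q1] := hq.
have hb' := burke_tilt hb lt1; have [_ hu' hq' _] := hb'.
rewrite exp_moment_right //; last exact: geo_weights.
rewrite (stationary_transfer_iter m n hb' (nu := geo q)
  (z := (tilt_geo q (- xi) / q)%R)) //.
- by rewrite Exn_cst1 ?mule1 -?EFinM //; apply: bern_prob.
- exact: geo_prob.
- by move=> k; apply: geo_untilt.
Qed.

(** With the true left law, which is stochastically larger than the coupled one,
    the right increments can only be larger. *)
Lemma horizontal_moment_le p u q xi m n : burke_parameters p u q ->
  (0 <= xi)%R -> ((1 - q) * expR (- xi) < 1)%R ->
  (bern_mgf u xi ^+ m * (tilt_geo q (- xi) / q) ^+ n)%:E <=
  exp_moment p u (geo q) xi m n.
Proof.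
move=> hb xi0 lt1; have [hp hu hq E] := hb; have /andP[q0 q1] := hq.
have hb' := burke_tilt hb lt1; have [_ hu' hq' _] := hb'.
have [t0 t1] := andP hq'.
rewrite -(horizontal_moment m n hb lt1) !exp_moment_right //; try exact: geo_weights.
rewrite lee_wpmul2l ?lee_fin ?exprn_ge0 ?(ltW (bern_mgf_gt0 _ _)) //.
apply: Exn_le => [|s|s sm]; first exact: bern_weights.
  by apply: transfer_iter_ge0 => //; apply: geo_weights.
apply: (transfer_iter_geo_mono (m := m)) => //.
- by apply: tilt_geo_ge => //; rewrite oppr_le0.
- exact: exp_monoR.
Qed.

(** The mirror image: the bottom law is coupled to the tilted left law, and the
    increments along the top are independent. *)
Lemma vertical_moment p u q xi m n : burke_parameters p u q ->
  ((1 - q) * expR xi < 1)%R ->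
  exp_moment p (tilt_bern u (- xi)) (geo q) xi m n =
  ((q / tilt_geo q xi) ^+ n * (bern_mgf u (- xi))^-1 ^+ m)%:E.
Proof.
move=> hb lt1; have [hp hu hq E] := hb; have /andP[q0 q1] := hq.
have hb' : burke_parameters p (tilt_bern u (- xi)) (tilt_geo q xi).
  by rewrite -{2}[xi]opprK; apply: burke_tilt; rewrite ?opprK.
have [_ hu' hq' _] := hb'.
rewrite exp_moment_left //.
rewrite (stationary_transfer_iter m n hb' (nu := geo (tilt_geo q xi)) (z := 1%R)) //.
- rewrite expr1n mul1e EFinM; congr (_ * _).
  under eq_Exn => s _ do rewrite -[exp_sum _ _]mule1.
  rewrite (Exn_tilt (mu := bern u) (c := (bern_mgf u (- xi))^-1%R)) //.
  + by rewrite Exn_cst1 ?mule1 //; apply: bern_prob.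
  + exact: bern_weights.
  + exact: bern_weights.
  + by move=> k; apply: bern_untilt.
- exact: geo_prob.
- by move=> s; apply: exp_sum_ge0.
Qed.

Lemma sumn_all2_leq s t : all2 leq s t -> (sumn s <= sumn t)%N.
Proof.
by elim: s t => [|a s IH] [|b t] //= /andP[ab /IH]; apply: leq_add.
Qed.

(** The true bottom law is stochastically larger than the coupled one, and the top
    increments rise with the bottom ones. *)
Lemma vertical_moment_le p u q xi m n : burke_parameters p u q ->
  (0 <= xi)%R -> ((1 - q) * expR xi < 1)%R ->
  ((q / tilt_geo q xi) ^+ n * (bern_mgf u (- xi))^-1 ^+ m)%:E <=
  exp_moment p u (geo q) xi m n.
Proof.
move=> hb xi0 lt1; have [hp hu hq E] := hb; have /andP[q0 q1] := hq.
have ht := tilt_geo_itv q1 lt1; have /andP[t0 t1] := ht.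
have hu' := tilt_bern_itv (- xi) hu; have [u'0 u'1] := andP hu'.
rewrite -(vertical_moment m n hb lt1) !exp_moment_left //.
rewrite lee_wpmul2l ?lee_fin ?exprn_ge0 ?divr_ge0 ?(ltW q0) ?(ltW t0) //.
apply: Exn_bern_mono => //.
- by apply: tilt_bern_le => //; rewrite oppr_le0.
- by case/andP: hu.
- move=> s; apply: transfer_iter_ge0 => //; first exact: geo_weights.
  by move=> s'; apply: exp_sum_ge0.
elim: n => [s s' _ ss'|n IH] /=.
  by rewrite lee_fin exp_monoR // sumn_all2_leq.
apply: transfer_nondecreasing => //; first exact: geo_weights.
move=> s; apply: transfer_iter_ge0 => //; first exact: geo_weights.
by move=> s'; apply: exp_sum_ge0.
Qed.

End Tilting.

(** * Bounds on the exponential moments *)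

Section MomentBounds.
Context {R : realType}.
Local Open Scope ereal_scope.

Lemma EvD (mu : vertex -> nat -> R) J F G w : (forall v, weights (mu v)) ->
  (forall w', 0 <= F w') -> (forall w', 0 <= G w') ->
  Ev mu J (fun w' => F w' + G w') w = Ev mu J F w + Ev mu J G w.
Proof.
move=> mu0 F0 G0; elim: J w => //= v J IH w; rewrite -ExD //.
- by apply: eq_Ex => k; apply: IH.
- by move=> k; apply: Ev_ge0.
- by move=> k; apply: Ev_ge0.
Qed.

(** Each half of the passage time ignores one boundary.  Replace the law there by
    the one that makes the exponential moment explicit, and then bound the half by
    the whole passage time. *)
Lemma exp_moment_le_sum (p u q xi : R) m n : burke_parameters p u q ->
  (0 <= xi)%R -> ((1 - q) * expR xi < 1)%R ->
  exp_moment p u (geo q) xi m n <=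
  (bern_mgf u xi ^+ m * (tilt_geo q (- xi) / q) ^+ n)%:E +
  ((q / tilt_geo q xi) ^+ n * (bern_mgf u (- xi))^-1 ^+ m)%:E.
Proof.
move=> hb xi0 lt1; have [hp hu hq _] := hb; have /andP[q0 q1] := hq.
have lt1' : ((1 - q) * expR (- xi) < 1)%R.
  apply: le_lt_trans lt1; rewrite ler_wpM2l ?subr_ge0 // ler_expR.
  by apply: (@le_trans _ _ 0%R); rewrite ?oppr_le0.
have [_ _ hq' _] := burke_tilt hb lt1'.
have hu'' := tilt_bern_itv (- xi) hu.
pose w0 : vertex -> nat := fun=> 0%N.
have pm a r : (0 <= a <= 1)%R -> (0 < r <= 1)%R ->
    forall v, prob_weights (model p a (geo r) v).
  by move=> ha hr v; apply: model_prob => //; apply: geo_prob.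
have wm a r : (0 <= a <= 1)%R -> (0 < r <= 1)%R ->
    forall v, weights (model p a (geo r) v).
  by move=> ha hr v; case: (pm a r ha hr v).
have EvE a r : (0 < r <= 1)%R -> exp_moment p a (geo r) xi m n =
    Ev (model p a (geo r)) (grid m n)
       (fun w' => (expR (xi * (growth w' m n)%:R))%:E) w0.
  by move=> hr; rewrite Ev_growth //; apply: geo_weights.
have e0 k : 0 <= (expR (xi * k%:R))%:E :> \bar R by rewrite lee_fin expR_ge0.
have emono k l : (k <= l)%N ->
    (expR (xi * k%:R))%:E <= (expR (xi * l%:R))%:E :> \bar R.
  by move=> kl; rewrite lee_fin exp_monoR.
rewrite -(horizontal_moment m n hb lt1') -(vertical_moment m n hb lt1).
rewrite !EvE //.
apply: le_trans (_ : _ <= Ev (model p u (geo q)) (grid m n) (fun w' =>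
  (expR (xi * (horizontal_passage w' m n)%:R))%:E +
  (expR (xi * (vertical_passage w' m n)%:R))%:E) w0) _.
  apply: Ev_le => // [|w']; first exact: wm.
  rewrite -boundary_growth boundary_last_passageE.
  by case: leqP => _; [rewrite leeDr|rewrite leeDl].
rewrite EvD //; last exact: wm.
apply: leeD.
- rewrite (Ev_irrelevant (mu' := model p u (geo (tilt_geo q (- xi))))
    (S := fun v => v.1 == 0%N)) //.
  + apply: Ev_le => // [|w']; first exact: wm.
    by apply: emono; apply: horizontal_passage_le_growth.
  + by case=> [[|i] [|j]].
  + exact: pm.
  + exact: pm.
  + move=> w1 w2 w12; congr (expR (xi * _%:R))%:E.
    by apply: horizontal_passage_congr => v v0; apply: w12; rewrite inE -lt0n.
- rewrite (Ev_irrelevant (mu' := model p (tilt_bern u (- xi)) (geo q))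
    (S := fun v => v.2 == 0%N)) //.
  + apply: Ev_le => // [|w']; first exact: wm.
    by apply: emono; apply: vertical_passage_le_growth.
  + by case=> [[|i] [|j]].
  + exact: pm.
  + exact: pm.
  + move=> w1 w2 w12; congr (expR (xi * _%:R))%:E.
    by apply: vertical_passage_congr => v v0; apply: w12; rewrite inE -lt0n.
Qed.

Lemma grid_in m n v : v \in grid m n <->
  [/\ (v.1 <= m)%N, (v.2 <= n)%N & v != (0%N, 0%N)].
Proof.
elim: n => [|n IH] /=.
  split=> [/mapP[i + ->]|]; first by rewrite mem_iota /= add0n => ?; split.
  case: v => [[|i] [|j]] [] //= im _ _.
  by apply/mapP; exists i; rewrite // mem_iota.
rewrite mem_cat inE; split.
- case/orP => [/IH[? ? ?]|/orP[/eqP ->|/mapP[i + ->]]]; first by split=> //; apply: leqW.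
    by split.
  by rewrite mem_iota /= add0n => ?; split.
- case: v IH => i j IH [/= im jn ij]; rewrite leq_eqVlt in jn.
  case/orP: jn => [/eqP -> {IH ij}|jn]; last by apply/orP; left; apply/IH.
  apply/orP; right; case: i im => [|i] im; first by rewrite eqxx.
  by apply/orP; right; apply/mapP; exists i; rewrite // mem_iota.
Qed.

Lemma grid_uniq m n : uniq (grid m n).
Proof.
elim: n => [|n IH]; first by rewrite map_inj_uniq ?iota_uniq // => i j [].
rewrite [grid _ _]/= cat_uniq IH cons_uniq map_inj_uniq ?iota_uniq; last first.
  by move=> i j [].
rewrite andTb andbT; apply/andP; split; last by apply/mapP => -[].
apply/hasPn => v; rewrite inE => vn; apply/negP => /grid_in[_ + _].
by case/orP: vn => [/eqP ->|/mapP[i _ ->]]; rewrite /= ltnn.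
Qed.

End MomentBounds.

(** * Passage to the given environment *)

Section MomentOfP.
Context {d : measure_display} {T : measurableType d} {R : realType}.
Context (P : probability T R).
Local Open Scope ereal_scope.

Lemma bernoulli_pmf (X : {RV P >-> nat}) (a : R) k : bernoulli_law X a ->
  P [set x | X x = k] = (bern a k)%:E.
Proof.
move=> [X1 X0]; case: k => [//|[//|k]] /=.
have mX i : measurable [set x | X x = i].
  exact: (measurable_level (fun=> X) (0%N, 0%N)).
have H : P ([set x | X x = 0%N] `|` [set x | X x = 1%N]) = 1.
  rewrite measureU //; first by rewrite [X in X + _]X0 [X in _ + X]X1 -EFinD subrK.
  by apply/seteqP; split => // x [/= ->].
set A := _ `|` _ in H; have mA : measurable A by apply: measurableU.
apply/eqP; rewrite eq_le measure_ge0 andbT.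
apply: (@le_trans _ _ (P (~` A))); last by rewrite probability_setC // H subee.
apply: le_measure; rewrite ?inE //; first exact: measurableC.
by move=> x /= Xx [] /=; rewrite Xx.
Qed.

Lemma environment_pmf (p u : R) w v k : invariant_environment (P := P) p u w ->
  v != (0%N, 0%N) ->
  P [set x | w v x = k] = (model p u (geo (q_geom p u)) v k)%:E.
Proof.
move=> [_ bulk bottom left _]; case: v => [[|i] [|j]] //= _.
- exact: left.
- exact: bernoulli_pmf.
- exact: bernoulli_pmf.
Qed.

Lemma q_geom_burke (p u : R) : (0 < p < 1)%R -> (p < u <= 1)%R ->
  burke_parameters p u (q_geom p u).
Proof.
move=> /andP[p0 p1] /andP[pu u1]; have u0 : (0 < u)%R by lra.
have d0 : (0 < u * (1 - p))%R by rewrite mulr_gt0 // subr_gt0.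
split; try (apply/andP; split; lra).
- rewrite /q_geom divr_gt0 ?subr_gt0 //= ler_pdivrMr // mul1r.
  have : (0 <= p * (1 - u))%R by rewrite mulr_ge0 ?subr_ge0 // ltW.
  lra.
- have u'0 : u != 0%R by rewrite gt_eqF.
  have p'0 : (1 - p)%R != 0%R by rewrite gt_eqF // subr_gt0.
  by rewrite /q_geom; field; rewrite u'0 p'0.
Qed.

Lemma expectation_growth (p u : R) (w : vertex -> {RV P >-> nat}) (xi : R) m n :
  (0 < p < 1)%R -> (p < u <= 1)%R -> invariant_environment p u w ->
  'E_P[fun x => expR (xi * (G_inv w m n x)%:R)] =
  exp_moment p u (geo (q_geom p u)) xi m n.
Proof.
move=> hp hu hw; have hb := q_geom_burke hp hu; have [hp' hu' hq _] := hb.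
have q0 := geo_weights hq.
rewrite unlock /exp_moment -(Ev_growth u xi m n (fun=> 0%N) hp' q0).
have [w_indep _ _ _ _] := hw.
rewrite -(expectation_env (P := P) w_indep).
- by apply: eq_integral => x _; rewrite /G_inv boundary_growth.
- exact: grid_uniq.
- move=> e e' ee'; congr (expR (xi * _%:R))%:E; apply: growth_congr.
  by move=> v v1 v2 v0; apply: ee'; apply/grid_in.
- by move=> v; apply: (proj1 (model_prob v hp' hu' (geo_prob hq))).
- by move=> e; rewrite lee_fin expR_ge0.
- by move=> v /grid_in[_ _ v0] k; apply: environment_pmf.
Qed.

End MomentOfP.

(** * The limit *)

Section Limit.
Context {R : realType}.
Implicit Types (p u q s t xi : R).

Lemma cvg_inv_nat : (N%:R^-1 : R) @[N --> \oo] --> 0.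
Proof. by rewrite -cvg_shiftS; exact: cvg_harmonic. Qed.

Lemma cvg_truncn s : 0 <= s ->
  N%:R^-1 * (Num.truncn (N%:R * s))%:R @[N --> \oo] --> s.
Proof.
move=> s0; apply: (@squeeze_cvgr _ _ _ _ (fun N : nat => s - N%:R^-1) (fun=> s)).
- near=> N; have N0 : 0 < N%:R :> R by rewrite ltr0n; near: N; exact: nbhs_infty_gt.
  have /truncn_itv/andP[h1 h2] : 0 <= N%:R * s by rewrite mulr_ge0 // ltW.
  rewrite ler_pdivrMl // h1 andbT -(ler_pM2l N0) mulVKf ?gt_eqF //.
  rewrite mulrBr mulfV ?gt_eqF // lerBlDr -natr1 in h2 *.
  exact: ltW.
- rewrite -[X in _ --> X]subr0; apply: cvgB; [exact: cvg_cst|exact: cvg_inv_nat].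
- exact: cvg_cst.
Unshelve. all: by end_near. Qed.

(** A sum of two exponentials is within a factor 2 of the larger one, which does
    not matter on the scale of N^-1 log. *)
Lemma cvg_scaled_lne (E : nat -> \bar R) (m n : nat -> nat) (a1 a2 b1 b2 s t : R) :
  N%:R^-1 * (m N)%:R @[N --> \oo] --> s ->
  N%:R^-1 * (n N)%:R @[N --> \oo] --> t ->
  (forall N, (expR ((m N)%:R * a1 + (n N)%:R * a2))%:E <= E N)%E ->
  (forall N, (expR ((m N)%:R * b1 + (n N)%:R * b2))%:E <= E N)%E ->
  (forall N, E N <= (expR ((m N)%:R * a1 + (n N)%:R * a2))%:E +
                    (expR ((m N)%:R * b1 + (n N)%:R * b2))%:E)%E ->
  ((N%:R^-1)%:E * lne (E N))%E @[N --> \oo] -->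
  (Num.max (s * a1 + t * a2) (s * b1 + t * b2))%:E.
Proof.
move=> ms nt leA leB leAB.
pose a N := (m N)%:R * a1 + (n N)%:R * a2.
pose b N := (m N)%:R * b1 + (n N)%:R * b2.
pose c N := N%:R^-1 * Num.max (a N) (b N).
have [y yE] : exists y : nat -> R, E = EFin \o y.
  exists (fine \o E); apply/funext => N /=; rewrite fineK // ge0_fin_numE.
    by apply: le_lt_trans (leAB N) _; rewrite -EFinD ltry.
  by apply: le_trans (leA N); rewrite lee_fin expR_ge0.
rewrite {}yE in leA leB leAB *.
have {}leA N : expR (a N) <= y N by rewrite -lee_fin; apply: leA.
have {}leB N : expR (b N) <= y N by rewrite -lee_fin; apply: leB.
have {}leAB N : y N <= expR (a N) + expR (b N).
  by rewrite -lee_fin EFinD; apply: leAB.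
have y0 N : 0 < y N by apply: lt_le_trans (leA N); apply: expR_gt0.
have -> : (fun N => (N%:R^-1)%:E * lne ((EFin \o y) N))%E =
          EFin \o (fun N => N%:R^-1 * ln (y N)).
  by apply/funext => N; rewrite [lne _]lne_EFin.
have lim_lin x1 x2 : N%:R^-1 * ((m N)%:R * x1 + (n N)%:R * x2)
    @[N --> \oo] --> s * x1 + t * x2.
  under eq_fun do rewrite mulrDr !mulrA.
  by apply: cvgD; apply: cvgMr_tmp.
apply: cvg_EFin; first by near=> N.
have cc : c N @[N --> \oo] --> Num.max (s * a1 + t * a2) (s * b1 + t * b2).
  have -> : c = fun N => 2^-1 * (N%:R^-1 * a N + N%:R^-1 * b N +
      `|N%:R^-1 * a N - N%:R^-1 * b N|).
    apply/funext => N; rewrite /c maxr_absE -mulrBr normrM (ger0_norm (x := N%:R^-1)).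
      by move: (N%:R^-1) => r; field.
    by rewrite invr_ge0.
  rewrite maxr_absE [X in _ --> X]mulrC.
  apply: cvgMl_tmp; apply: cvgD; first by apply: cvgD; apply: lim_lin.
  by apply: cvg_norm; apply: cvgB; apply: lim_lin.
have lb N : Num.max (a N) (b N) <= ln (y N).
  rewrite ge_max; apply/andP; split; rewrite -ler_expR lnK ?posrE //.
have ub N : ln (y N) <= Num.max (a N) (b N) + ln 2.
  rewrite -ler_expR lnK ?posrE // expRD lnK ?posrE //.
  apply: le_trans (leAB N) _; rewrite mulr_natr mulr2n lerD // ler_expR le_max.
    by rewrite lexx.
  by rewrite lexx orbT.
apply: (@squeeze_cvgr _ _ _ _ c (fun N => c N + N%:R^-1 * ln 2)).
- near=> N; rewrite /= /c -mulrDr; apply/andP.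
  by split; apply: ler_wpM2l; rewrite ?invr_ge0.
- exact: cc.
- rewrite -[X in _ --> X]addr0; apply: cvgD => //.
  by rewrite -[X in _ --> X](mul0r (ln 2)); apply: cvgMr_tmp; exact: cvg_inv_nat.
Unshelve. all: by end_near. Qed.

Lemma C_G_domain q x : 0 < q <= 1 ->
  (x%:E < - lne (1 - q)%:E)%E = ((1 - q) * expR x < 1).
Proof.
move=> /andP[q0 q1]; have [q1'|q1'] := eqVneq q 1.
  by rewrite q1' subrr mul0r ltr01 le0_lneNy //= ltry.
have d0 : 0 < 1 - q by rewrite subr_gt0 lt_neqAle q1'.
rewrite lne_EFin // -EFinN lte_fin -ltr_expR expRN lnK ?posrE //.
by rewrite -(ltr_pM2l d0) mulfV // gt_eqF.
Qed.

Lemma C_GE q x : 0 < q <= 1 -> (1 - q) * expR x < 1 ->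
  C_G q x = (ln (q / tilt_geo q x))%:E.
Proof. by move=> hq lt1; rewrite /C_G C_G_domain // lt1. Qed.

Lemma lt_xi_max p u xi : 0 < p < 1 -> p < u <= 1 ->
  (xi%:E < xi_max p u)%E = ((1 - q_geom p u) * expR xi < 1).
Proof.
move=> hp hu; have [hp' hu' hq E] := q_geom_burke hp hu.
have [/andP[p0 p1] /andP[pu u1]] := conj hp hu; have u0 : 0 < u by lra.
have d0 : 0 < u * (1 - p) by rewrite mulr_gt0 // subr_gt0.
have qE : 1 - q_geom p u = p * (1 - u) / (u * (1 - p)).
  by apply: (mulfI (lt0r_neq0 d0)); rewrite -E mulrCA mulfV ?gt_eqF // mulr1 mulrC.
rewrite qE /xi_max; have [->|u1'] := eqVneq u 1.
  rewrite subrr mulr0 mul0r mul0r ltr01 inve0 gt0_muley ?ltry //.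
  by rewrite lte_fin mul1r subr_gt0.
have e0 : 0 < p * (1 - u) by rewrite mulr_gt0 // subr_gt0 lt_neqAle u1'.
rewrite inver gt_eqF // -EFinM lne_EFin ?divr_gt0 // lte_fin -ltr_expR.
by rewrite lnK ?posrE ?divr_gt0 // ltr_pdivlMr // mulrAC ltr_pdivrMr // mul1r mulrC.
Qed.

(** Lambda is the larger of the two exponential rates.  Clearing the denominator D
    of ell turns its threshold into a comparison of the rates; if D = 0 then
    q = 1 or xi = 0, and the two rates agree. *)
Lemma LambdaE p u s t xi : 0 < p < 1 -> p < u <= 1 -> 0 <= s -> 0 <= t -> 0 <= xi ->
  (1 - q_geom p u) * expR xi < 1 ->
  let q := q_geom p u in
  Lambda p u s t xi =
  (Num.max (s * ln (bern_mgf u xi) + t * ln (tilt_geo q (- xi) / q))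
           (s * - ln (bern_mgf u (- xi)) + t * ln (q / tilt_geo q xi)))%:E.
Proof.
move=> hp hu s0 t0 xi0 lt1 q.
have [hp' hu' hq E] := q_geom_burke hp hu; rewrite -/q in hq E lt1.
have /andP[q0 q1] := hq.
have em : expR (- xi) <= expR xi.
  by rewrite ler_expR; apply: (@le_trans _ _ 0); rewrite ?oppr_le0.
have lt1' : (1 - q) * expR (- xi) < 1.
  by apply: le_lt_trans lt1; rewrite ler_wpM2l ?subr_ge0.
have [t1 t2] := (tilt_geo_itv q1 lt1, tilt_geo_itv q1 lt1').
rewrite /Lambda /ell lt_xi_max // -/q lt1 !C_GE // -!EFinM -!EFinD.
clearbody q; set n := C_B u xi + C_B u (- xi).
set D := ln (q / tilt_geo q xi) + ln (q / tilt_geo q (- xi)).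
have -> : ln (tilt_geo q (- xi) / q) = - ln (q / tilt_geo q (- xi)).
  rewrite -lnV ?posrE ?divr_gt0 //; last by case/andP: t2.
  by rewrite invf_div.
rewrite -[ln (bern_mgf u xi)]/(C_B u xi) -[ln (bern_mgf u (- xi))]/(C_B u (- xi)).
have /andP[t1_gt0 _] := t1; have /andP[t2_gt0 _] := t2.
pose e := expR xi; have e0 : 0 < e by apply: expR_gt0.
have DE : D = ln (q / tilt_geo q xi * (q / tilt_geo q (- xi))).
  by rewrite lnM ?posrE ?divr_gt0.
(* D >= 0, with equality only if q = 1 or e = 1, because of this square *)
have gap : q * q - tilt_geo q xi * tilt_geo q (- xi) = (1 - q) * (e - 1) ^+ 2 / e.
  by rewrite /tilt_geo expRN -/e; field; rewrite gt_eqF.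
have ratioE : q / tilt_geo q xi * (q / tilt_geo q (- xi)) =
    q * q / (tilt_geo q xi * tilt_geo q (- xi)).
  by rewrite mulrACA -invfM.
have tt0 : 0 < tilt_geo q xi * tilt_geo q (- xi) by apply: mulr_gt0.
have D0 : 0 <= D.
  rewrite DE ratioE ln_ge0 // ler_pdivlMr // mul1r -subr_ge0 gap.
  apply: divr_ge0; last exact: ltW.
  by apply: mulr_ge0; rewrite ?sqr_ge0 ?subr_ge0.
have Dn : D = 0 -> n = 0.
  rewrite DE ratioE => /eqP; rewrite ln_eq0 ?divr_gt0 ?mulr_gt0 // => /eqP H.
  have : (1 - q) * (e - 1) ^+ 2 = 0.
    apply: (mulIf (x := e^-1)); first by rewrite invr_eq0 gt_eqF.
    by rewrite -gap mul0r -(divfK (lt0r_neq0 tt0) (q * q)) H mul1r subrr.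
  move/eqP; rewrite mulf_eq0 expf_eq0 /= => /orP[/eqP q1'|/eqP e1].
  - move: E; rewrite q1' mulr0 => /eqP; rewrite mulf_eq0 [p == 0]gt_eqF; last by case/andP: hp.
    rewrite orbF => /eqP u1.
    by rewrite /n /C_B u1 (_ : u = 1) ?mul1r ?add0r ?expRK ?subrr //; lra.
  - have xiE : xi = 0 by apply: expR_inj; rewrite expR0 -/e; lra.
    by rewrite /n /C_B xiE oppr0 expR0 mulr1 subrK ln1 addr0.
have [D_gt0|D_le0] := ltP 0 D.
  rewrite inver gt_eqF // -!EFinM lte_fin mulrAC ltr_pdivlMr //.
  case: ltP => [lt|le]; congr (_%:E).
    by rewrite max_l ?mulrN //; move: lt; rewrite /n /D => lt; lra.
  by rewrite max_r ?mulrN //; [lra|move: le; rewrite /n /D => le; lra].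
have D00 : D = 0 by apply/eqP; rewrite eq_le D_le0.
have n0 := Dn D00; rewrite n0 !mul0e lte_fin ltNge t0 /=.
congr (_%:E); move: n0 D00; rewrite /n /D => n0 D00.
have -> : C_B u xi = - C_B u (- xi) by lra.
have -> : ln (q / tilt_geo q (- xi)) = - ln (q / tilt_geo q xi) by lra.
by rewrite opprK maxxx mulrN addrC.
Qed.

End Limit.

(** * The infinite moment and the theorem *)

Section InfiniteMoment.
Context {d : measure_display} {T : measurableType d} {R : realType}.
Context (P : probability T R).

(** By memorylessness the value x satisfies x = q + (1 - q) e^xi x >= q + x, which
    no finite x does. *)
Lemma Ex_geo_infinite (q xi : R) : 0 < q <= 1 -> 1 <= (1 - q) * expR xi ->
  Ex (geo q) (fun k => (expR (xi * k%:R))%:E) = +oo%E.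
Proof.
move=> hq ge1; have /andP[q0 q1] := hq; have g0 := geo_weights hq.
set f := fun k => _; have f0 k : (0 <= f k)%E by rewrite lee_fin expR_ge0.
have := Ex_geo_recl hq f0.
have -> : Ex (geo q) (fun k => f k.+1) = ((expR xi)%:E * Ex (geo q) f)%E.
  rewrite -ExZl //; apply: eq_Ex => k; rewrite /f -EFinM -expRD.
  by rewrite -[X in X + _]mulr1 -mulrDr -natr1 addrC.
have : (0 <= Ex (geo q) f)%E by apply: Ex_ge0.
case: (Ex (geo q) f) => // x x0.
rewrite /f mulr0 expR0 mule1 -!EFinM -EFinD => -[xE].
rewrite lee_fin in x0; have := ler_wpM2r x0 ge1; rewrite mul1r -mulrA.
by rewrite {1}xE gerDr leNgt q0.
Qed.

(** The passage time is at least the first weight on the left axis, whose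
    exponential moment is already infinite. *)
Lemma expectation_infinite (p u xi : R) (w : vertex -> {RV P >-> nat}) m n :
  0 < p < 1 -> p < u <= 1 -> invariant_environment p u w -> 0 <= xi ->
  1 <= (1 - q_geom p u) * expR xi -> (0 < n)%N ->
  ('E_P[fun x => expR (xi * (G_inv w m n x)%:R)] = +oo)%E.
Proof.
move=> hp hu hw xi0 ge1 n0; have [hp' hu' hq _] := q_geom_burke hp hu.
have [w_indep _ _ left _] := hw.
have e0 e k : (0 <= (expR (xi * (e k)%:R))%:E :> \bar R)%E.
  by move=> *; rewrite lee_fin expR_ge0.
pose F (e : vertex -> nat) : \bar R := (expR (xi * (e (0, 1))%:R))%:E.
pose G (e : vertex -> nat) : \bar R := (expR (xi * (growth e m n)%:R))%:E.
have dF : depends_on [:: (0, 1)%N] F.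
  by move=> e e' ee'; rewrite /F ee' // inE.
have dG : depends_on (grid m n) G.
  move=> e e' ee'; rewrite /G (growth_congr (w' := e')) // => v v1 v2 v0.
  by apply: ee'; apply/grid_in.
apply/eqP; rewrite -leye_eq -(Ex_geo_infinite hq ge1) unlock.
have <- : (\int[P]_x F (env w x) = Ex (geo (q_geom p u))
    (fun k => (expR (xi * k%:R))%:E))%E.
  rewrite (expectation_env (mu := model p u (geo (q_geom p u)))
    (L := [:: (0, 1)%N]) w_indep (fun=> 0%N)) //.
  - by move=> v; apply: (proj1 (model_prob v hp' hu' (geo_prob hq))).
  - by move=> e; rewrite lee_fin expR_ge0.
  - by move=> v; rewrite inE => /eqP -> k; apply: environment_pmf.
rewrite [leRHS](eq_integral (G \o env w)) => [|x _]; last first.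
  by rewrite /G /G_inv /= boundary_growth.
apply: ge0_le_integral => //.
- by move=> x _; rewrite lee_fin expR_ge0.
- exact: measurable_env dF.
- exact: measurable_env dG.
- move=> x _; rewrite lee_fin exp_monoR //.
  apply: leq_trans (growth_le _ (leq0n m) (leqnn n)).
  apply: leq_trans (growth_le _ (leqnn 0) n0).
  by rewrite /= big_nat1.
Qed.

End InfiniteMoment.

(* The value +oo is wrong when t = 0 and xi >= xi_max (the model is then a sum of
   Bernoulli weights), so the formula is asserted away from that corner; the
   limit is asserted to exist in all cases. *)
Theorem theorem5p2 (d : measure_display) (T : measurableType d) (R : realType)
    (P : probability T R) (p u s t : R) (w : nat * nat -> {RV P >-> nat})
    (hp : 0 < p < 1) (hs : 0 <= s) (ht : 0 <= t) (hu : p < u <= 1)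
    (hw : invariant_environment p u w) (xi : R) (hxi : 0 <= xi) :
  cvgn (scaled_log_mgf w s t xi) /\
  (0 < t \/ (xi%:E < xi_max p u)%E ->
     limn (scaled_log_mgf w s t xi) = Lambda p u s t xi).
Proof.
have hb := q_geom_burke hp hu; have [hp' hu' hq _] := hb.
have /andP[q0 q1] := hq; set q := q_geom p u in hb hq q0 q1.
pose m N := Num.truncn (N%:R * s); pose n N := Num.truncn (N%:R * t).
pose E N := ('E_P[fun x => expR (xi * (G_inv w (m N) (n N) x)%:R)])%E.
have sE : scaled_log_mgf w s t xi = fun N => ((N%:R^-1)%:E * lne (E N))%E by [].
have EE N : E N = exp_moment p u (geo q) xi (m N) (n N).
  exact: (expectation_growth xi (m N) (n N) hp hu hw).
have ms := cvg_truncn hs; have nt := cvg_truncn ht.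
have expRk k (x : R) : 0 < x -> expR (k%:R * ln x) = x ^+ k.
  by move=> x0; rewrite expRM_natl lnK.
have Z0 x := bern_mgf_gt0 x hu'.
have [lt1|ge1] := ltP ((1 - q) * expR xi) 1.
  have lt1' : (1 - q) * expR (- xi) < 1.
    apply: le_lt_trans lt1; rewrite ler_wpM2l ?subr_ge0 // ler_expR.
    by apply: (@le_trans _ _ 0); rewrite ?oppr_le0.
  have /andP[t1 _] := tilt_geo_itv q1 lt1.
  have /andP[t2 _] := tilt_geo_itv q1 lt1'.
  have r1 : 0 < tilt_geo q (- xi) / q by rewrite divr_gt0.
  have r2 : 0 < q / tilt_geo q xi by rewrite divr_gt0.
  have Hcvg : scaled_log_mgf w s t xi @ \oo --> Lambda p u s t xi.
    rewrite LambdaE // sE; apply: (cvg_scaled_lne ms nt) => N.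
    - rewrite expRD !expRk // EE.
      exact: horizontal_moment_le.
    - rewrite addrC expRD -lnV ?posrE // !expRk ?invr_gt0 //.
      rewrite EE.
      exact: vertical_moment_le.
    - rewrite [X in (_ + (expR X)%:E)%E]addrC -lnV ?posrE // !expRD.
      rewrite !expRk ?invr_gt0 //.
      rewrite EE.
      exact: exp_moment_le_sum.
  by split; [apply/cvg_ex; eexists; exact: Hcvg|move=> _; exact/cvg_lim].
have [t_gt0|t_le0] := ltP 0 t.
  have Hcvg : scaled_log_mgf w s t xi @ \oo --> Lambda p u s t xi.
    rewrite /Lambda lt_xi_max // ltNge ge1 /= sE; apply: cvg_near_cst; near=> N.
    have N0 : 0 < N%:R :> R by rewrite ltr0n; near: N; exact: nbhs_infty_gt.
    rewrite /E (expectation_infinite _ hp hu hw) //.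
      by rewrite gt0_muley // lte_fin invr_gt0.
    rewrite truncn_gt0 -ler_pdivrMr // mul1r; near: N.
    exact: nbhs_infty_ger.
  by split; [apply/cvg_ex; eexists; exact: Hcvg|move=> _; exact/cvg_lim].
have t0 : t = 0 by apply/eqP; rewrite eq_le t_le0.
split; last by move=> []; rewrite ?lt_xi_max // ltNge ?t_le0 ?ge1.
(* the endpoints are on the bottom axis, where the moment is a power *)
have Ebot N : E N = (expR ((m N)%:R * ln (bern_mgf u xi) + (n N)%:R * 0))%:E.
  rewrite EE /n t0 mulr0 truncn0 mulr0 addr0.
  rewrite expRk // exp_moment_right //; last exact: geo_weights.
  rewrite /= Exn_cst1 ?mule1 //.
  by apply: bern_prob; apply: tilt_bern_itv.
apply/cvg_ex; eexists; rewrite sE.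
pose c := ln (bern_mgf u xi).
apply: (cvg_scaled_lne (a1 := c) (a2 := 0) (b1 := c) (b2 := 0) ms nt) => N.
- by rewrite Ebot.
- by rewrite Ebot.
- by rewrite Ebot leeDl // lee_fin expR_ge0.
Unshelve. all: by end_near. Qed.
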